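(* Let $(Y_t)_{t=1}^\infty$ be a square-integrable martingale with respect to a filtration $(\mathcal F_t)$, taking values in the symmetric real $d\times d$ matrices, with $Y_0=0$. Let $\Delta Y_t=Y_t-Y_{t-1}$ and $V_t=\gamma_{\max}\left(\sum_{i=1}^t\mathbb{E}_{i-1}\Delta Y_i^2\right)$. Then $$\limsup_{t\to\infty}\frac{\gamma_{\max}(Y_t)}{\sqrt{2V_t\log\log V_t}}\le 1\quad\text{a.s. on }\left\{\sup_t V_t=\infty\right\}$$ whenever either (1) the increments $(\Delta Y_t)$ are i.i.d., or (2) the increments $(\Delta Y_t)$ satisfy a Bernstein condition on higher moments: for some $c>0$, for all $t$ and all integers $k>2$, $\mathbb{E}_{t-1}(\Delta Y_t)^k\preceq (k!/2)\,c^{k-2}\,\mathbb{E}_{t-1}\Delta Y_t^2$.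
   Context: $\gamma_{\max}(\cdot)$ is the maximum eigenvalue of a symmetric matrix, $\mathbb{E}_t$ denotes conditional expectation given $\mathcal F_t$, $\preceq$ is the positive semidefinite order, and powers are matrix powers. *)

(* Defs.v *)
From HB Require Import structures.
From mathcomp Require Import all_boot all_order all_algebra.
From mathcomp Require Import all_classical all_reals all_analysis.
Import Order.TTheory GRing.Theory Num.Theory.
Import numFieldNormedType.Exports.

Set Implicit Arguments.
Unset Strict Implicit.
Unset Printing Implicit Defensive.

Local Open Scope classical_set_scope.
Local Open Scope ring_scope.

(* For a symmetric A and 0 < n the set below is finite and nonempty, so its
   supremum is a maximum.  On other matrices the value is meaningless. *)
Definition gamma_max (R : realType) (n : nat) (A : 'M[R]_n) : R :=
  sup [set a | eigenvalue A a].

Definition psd_mx (R : realType) (n : nat) (A : 'M[R]_n) : Prop :=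
  A^T = A /\ forall u : 'rV[R]_n, 0 <= (u *m A *m u^T) 0 0.

Definition psd_le (R : realType) (n : nat) (A B : 'M[R]_n) : Prop :=
  psd_mx (B - A).

Definition filtration (d : measure_display) (T : measurableType d)
    (F : nat -> set (set T)) : Prop :=
  [/\ forall t, sigma_algebra setT (F t),
      forall t, F t `<=` measurable &
      forall s t, (s <= t)%N -> F s `<=` F t].

Definition measurable_wrt (d : measure_display) (T : measurableType d)
    (R : realType) (G : set (set T)) (X : T -> R) : Prop :=
  forall B : set R, measurable B -> G (X @^-1` B).

(* [cond_exp P G X Z]: Z is a version of E[X | G], which is determined only up
   to P-null sets. *)
Definition cond_exp (d : measure_display) (T : measurableType d)
    (R : realType) (P : probability T R) (G : set (set T)) (X Z : T -> R) :
    Prop :=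
  [/\ P.-integrable setT (EFin \o X),
      P.-integrable setT (EFin \o Z),
      measurable_wrt G Z &
      forall A, G A ->
        (\int[P]_(w in A) (Z w)%:E = \int[P]_(w in A) (X w)%:E)%E].

Definition cond_exp_mx (d : measure_display) (T : measurableType d)
    (R : realType) (P : probability T R) (n : nat) (G : set (set T))
    (X Z : T -> 'M[R]_n) : Prop :=
  forall i j, cond_exp P G (fun w => X w i j) (fun w => Z w i j).

(* The integrability of each Y t is part of [cond_exp]. *)
Definition martingale_mx (d : measure_display) (T : measurableType d)
    (R : realType) (P : probability T R) (n : nat)
    (F : nat -> set (set T)) (Y : nat -> T -> 'M[R]_n) : Prop :=
  (forall t i j, measurable_wrt (F t) (fun w => Y t w i j)) /\
  (forall t, cond_exp_mx P (F t) (Y t.+1) (Y t)).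

(* All norms on 'M_n being equivalent, E ||Y t||^2 < oo is expressed by
   square-integrability of the entries. *)
Definition square_integrable_mx (d : measure_display) (T : measurableType d)
    (R : realType) (P : probability T R) (n : nat)
    (Y : nat -> T -> 'M[R]_n) : Prop :=
  forall t i j, (fun w => Y t w i j) \in Lfun P 2%:E.

(* Meant for 1 <= t. *)
Definition increment (T : Type) (R : realType) (n : nat)
    (Y : nat -> T -> 'M[R]_n) (t : nat) (w : T) : 'M[R]_n :=
  Y t w - Y t.-1 w.

Definition borel_mx (R : realType) (n : nat) : set (set 'M[R]_n) :=
  <<s [set U : set 'M[R]_n | open U] >>.

Definition mutually_independent_mx (d : measure_display)
    (T : measurableType d) (R : realType) (P : probability T R) (n : nat)
    (X : nat -> T -> 'M[R]_n) : Prop :=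
  forall (s : seq nat) (B : nat -> set 'M[R]_n), uniq s ->
    (forall i, borel_mx (B i)) ->
    P (\bigcap_(i in [set` s]) (X i @^-1` B i)) =
    (\prod_(i <- s) P (X i @^-1` B i))%E.

Definition identically_distributed_mx (d : measure_display)
    (T : measurableType d) (R : realType) (P : probability T R) (n : nat)
    (X : nat -> T -> 'M[R]_n) : Prop :=
  forall (i j : nat) (B : set 'M[R]_n), borel_mx B ->
    P (X i @^-1` B) = P (X j @^-1` B).

Definition iid_mx (d : measure_display) (T : measurableType d)
    (R : realType) (P : probability T R) (n : nat)
    (X : nat -> T -> 'M[R]_n) : Prop :=
  mutually_independent_mx P X /\ identically_distributed_mx P X.

(* W t is a version of E_{t-1} (Delta Y_t)^2.  The existence of M includes the
   integrability of (Delta Y_t)^k. *)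
Definition bernstein_mx (d : measure_display) (T : measurableType d)
    (R : realType) (P : probability T R) (n : nat)
    (F : nat -> set (set T)) (Y W : nat -> T -> 'M[R]_n) : Prop :=
  exists2 c : R, 0 < c &
    forall t k : nat, (1 <= t)%N -> (2 < k)%N ->
      exists2 M : T -> 'M[R]_n,
        cond_exp_mx P (F t.-1) (fun w => increment Y t w ^+ k) M &
        {ae P, forall w,
          psd_le (M w) ((k`!%:R / 2 * c ^+ (k - 2)) *: W t w)}.

Definition intrinsic_time (T : Type) (R : realType) (n : nat)
    (W : nat -> T -> 'M[R]_n) (t : nat) (w : T) : R :=
  gamma_max (\sum_(1 <= i < t.+1) W i w).

(* Main.v *)
Require Import Defs.
From HB Require Import structures.
From mathcomp Require Import all_boot all_order all_algebra.
From mathcomp Require Import all_classical all_reals all_analysis.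
From mathcomp Require Import measurable_realfun zify ring lra.
Import Order.TTheory GRing.Theory Num.Theory.
Import numFieldNormedType.Exports.

Set Implicit Arguments.
Unset Strict Implicit.
Unset Printing Implicit Defensive.

Local Open Scope classical_set_scope.
Local Open Scope ring_scope.

                             

(** For a unit row vector [u], the process [qform u (Y t w)] is a scalar martingale. The square of
    its increment is at most [qform u] of the squared matrix increment, so its accumulated
    conditional variance is at most [V t w]. The scalar law of the iterated logarithm comes from
    exponential supermartingales $\exp(lM_t-\psi(l)A_t)$. Ville's inequality bounds by $e^{-a}$ the
    probability that such an exponent ever reaches $a$. Choosing [l] optimally on each slice of a
    geometric subdivision of the clock and applying Borel-Cantelli yields [upper_lil].

    The two cases differ in the supermartingale. Under the Bernstein condition [bernstein_expR]
    takes $A_t$ to be the sum of the conditional variances and $\psi(l)=(l^2/2)/(1-3cl)$. Matrix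
    moments enter by writing the exponential as the limit of $(1+y/N)^N$ with $N$ a power of two,
    and by moving the power inside the quadratic form. In the i.i.d. case there is no control of
    moments above the second, and conditional variances may be random, since the filtration may
    carry more than the past increments. There the inequality $e^{y-y^2/6}\le 1+y+y^2/3$ gives a
    supermartingale with $\psi(l)=l^2/2$, whose clock is one third of the squared increments plus
    two thirds of the conditional variances ([self_normalized_expR]). A truncation argument
    ([iid_dominated_sum_le]) shows that the squared increments eventually sum to at most
    $1+\varepsilon$ times the conditional variances, so this clock is eventually at most
    $(1+\varepsilon)V_t$.

    To reach the largest eigenvalue, the two-sided scalar bounds are imposed on finitely many
    directions for each accuracy. [grid_bound] extends them to all unit vectors with a factor
    tending to 1 as the grid is refined, and the variational description of [gamma_max] concludes
    after a countable intersection over accuracies. *)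

(** * Measurability with respect to a sub-sigma-algebra *)

Section measurable_wrt.
Context (d : measure_display) (T : measurableType d) (R : realType).
Variables (G : set (set T)) (sG : sigma_algebra setT G).
Implicit Types X Y : T -> R.

Lemma measurable_wrtE X :
  measurable_wrt G X <-> measurable_fun setT (X : g_sigma_algebraType G -> R).
Proof.
split=> [mX _ B mB|mX B mB].
  by rewrite setTI; apply: sub_sigma_algebra; exact: mX.
by have := mX measurableT B mB; rewrite setTI /measurable/= (sigma_algebra_id sG).
Qed.

Lemma measurable_subsigma (A : set T) :
  G A <-> measurable (A : set (g_sigma_algebraType G)).
Proof. by rewrite /measurable/= (sigma_algebra_id sG). Qed.

Lemma measurable_wrt_cst (c : R) : measurable_wrt G (fun=> c : R).
Proof. by apply/measurable_wrtE; exact: measurable_cst. Qed.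

Lemma measurable_wrtD X Y : measurable_wrt G X -> measurable_wrt G Y ->
  measurable_wrt G (fun w => X w + Y w).
Proof.
move=> /measurable_wrtE mX /measurable_wrtE mY.
by apply/measurable_wrtE; exact: measurable_funD.
Qed.

Lemma measurable_wrtB X Y : measurable_wrt G X -> measurable_wrt G Y ->
  measurable_wrt G (fun w => X w - Y w).
Proof.
move=> /measurable_wrtE mX /measurable_wrtE mY.
by apply/measurable_wrtE; exact: measurable_funB.
Qed.

Lemma measurable_wrtM X Y : measurable_wrt G X -> measurable_wrt G Y ->
  measurable_wrt G (fun w => X w * Y w).
Proof.
move=> /measurable_wrtE mX /measurable_wrtE mY.
by apply/measurable_wrtE; exact: measurable_funM.
Qed.

Lemma measurable_wrt_comp (f : R -> R) X : measurable_fun setT f ->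
  measurable_wrt G X -> measurable_wrt G (fun w => f (X w)).
Proof.
move=> mf /measurable_wrtE mX.
by apply/measurable_wrtE; exact: (measurableT_comp mf mX).
Qed.

Lemma measurable_wrt_sum (I : Type) (s : seq I) (f : I -> T -> R) :
  (forall i, measurable_wrt G (f i)) ->
  measurable_wrt G (fun w => \sum_(i <- s) f i w).
Proof.
move=> mf; apply/measurable_wrtE; apply: measurable_sum => i.
exact/measurable_wrtE.
Qed.

End measurable_wrt.

Section filtered.
Context (d : measure_display) (T : measurableType d) (R : realType).
Implicit Types (G : set (set T)) (X : T -> R).

Lemma measurable_wrt_fun G X : G `<=` measurable ->
  measurable_wrt G X -> measurable_fun setT X.
Proof. by move=> sG mX _ B mB; rewrite setTI; exact/sG/mX. Qed.

Lemma measurable_wrtS G G' X : G `<=` G' ->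
  measurable_wrt G X -> measurable_wrt G' X.
Proof. by move=> GG' mX B mB; exact/GG'/mX. Qed.

End filtered.

(** * Conditional inequalities integrated against weights *)

Section weights.
Context (d : measure_display) (T : measurableType d) (R : realType).
Variables (P : probability T R) (G : set (set T)).
Hypotheses (sG : sigma_algebra setT G) (Gm : G `<=` measurable).
Variables (Z1 Z2 : T -> R).
Hypotheses (mZ1 : measurable_fun setT Z1) (mZ2 : measurable_fun setT Z2).
Hypotheses (Z1_ge0 : forall w, 0 <= Z1 w) (Z2_ge0 : forall w, 0 <= Z2 w).
Hypothesis leZ : forall B, G B ->
  (\int[P]_(w in B) (Z1 w)%:E <= \int[P]_(w in B) (Z2 w)%:E)%E.

Import HBNNSimple.

Let nnsfun_weight (h : {nnsfun (g_sigma_algebraType G) >-> R}) B : G B ->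
  (\int[P]_(w in B) (h w * Z1 w)%:E <= \int[P]_(w in B) (h w * Z2 w)%:E)%E.
Proof.
move=> GB.
have expand (Z : T -> R) : measurable_fun setT Z -> (forall w, 0 <= Z w) ->
  (\int[P]_(w in B) (h w * Z w)%:E =
   \sum_(y \in range h) y%:E * \int[P]_(w in B `&` h @^-1` [set y]) (Z w)%:E)%E.
  move=> mZ Z0; have mB := Gm GB.
  have mh y : measurable (h @^-1` [set y] : set T).
    by apply/Gm/(measurable_subsigma sG).
  have hE w : (h w * Z w)%:E =
      (\sum_(y \in range h) y%:E * (\1_(h @^-1` [set y]) w * Z w)%:E)%E.
    rewrite (fimfunE h) mulr_fsuml -fsumEFin//.
    by apply: eq_fsbigr => y _; rewrite -EFinM mulrA.
  under eq_integral do rewrite hE.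
  rewrite ge0_integral_fsum//; last 2 first.
  - move=> y; apply: measurable_funeM; apply/measurable_EFinP.
    apply: measurable_funTS; apply: measurable_funM => //.
  - move=> y w _; rewrite -EFinM lee_fin.
    case: (boolP (h w == y)) => [/eqP <-|hwy].
      by rewrite mulr_ge0// mulr_ge0//.
    rewrite indicE memNset ?mul0r ?mulr0//=.
    by move=> /eqP; apply/negP.
  apply: eq_fsbigr => y _.
  case: (boolP (0 <= y)) => y0.
    rewrite ge0_integralZl//; last 2 first.
    - apply/measurable_EFinP.
      apply: measurable_funTS; apply: measurable_funM => //.
    - by move=> w _; rewrite lee_fin mulr_ge0.
    congr (_ * _)%E; rewrite integral_mkcondr.
    apply: eq_integral => w _; rewrite patchE indicE.
    by case: ifPn => _; rewrite ?mul1r ?mul0r.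
  have -> : h @^-1` [set y] = set0.
    by rewrite -subset0 => w /= hy; move: y0; rewrite -hy fun_ge0.
  rewrite setI0 integral_set0 mule0.
  by apply: integral0_eq => w _; rewrite indic0 mul0r mule0.
rewrite !expand//; apply: lee_fsum => // y [x _ <-].
apply: lee_wpmul2l; first by rewrite lee_fin.
apply: leZ; apply/(measurable_subsigma sG); apply: measurableI => //.
exact/(measurable_subsigma sG).
Qed.

(** Taking out what is known, in inequality form. For simple [g] the integrals split over level
    sets, which lie in [G]; monotone convergence does the rest. The approximating simple functions
    live on the measurable space generated by [G], so that their level sets stay in [G]. *)
Lemma weighted_integral_le (g : T -> R) : measurable_wrt G g ->
  (forall w, 0 <= g w) -> forall B, G B ->
  (\int[P]_(w in B) (g w * Z1 w)%:E <= \int[P]_(w in B) (g w * Z2 w)%:E)%E.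
Proof.
move=> /(measurable_wrtE sG) mg g0 B GB.
have mEg : measurable_fun setT (EFin \o g : g_sigma_algebraType G -> \bar R).
  exact/measurable_EFinP.
pose h n := nnsfun_approx (@measurableT _ (g_sigma_algebraType G)) mEg n.
have mh n : measurable_fun setT (h n : T -> R).
  apply: (@measurable_wrt_fun _ T R G) => //.
  by apply/measurable_wrtE.
have lim (Z : T -> R) : measurable_fun setT Z -> (forall w, 0 <= Z w) ->
  (\int[P]_(w in B) (h n w * Z w)%:E @[n --> \oo] -->
   \int[P]_(w in B) (g w * Z w)%:E)%E.
  move=> mZ Z0.
  have -> : (\int[P]_(w in B) (g w * Z w)%:E =
             \int[P]_(w in B) (limn (fun n => (h n w * Z w)%:E)))%E.
    apply: eq_integral => w _; apply/esym/cvg_lim => //.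
    apply: cvg_EFin; first exact: nearW.
    apply: cvgMl.
    have g0' x : [set: g_sigma_algebraType G] x -> (0 <= (EFin \o g) x)%E.
      by rewrite lee_fin.
    by have /fine_cvgP[_] := cvg_nnsfun_approx measurableT mEg g0' (I : setT w).
  apply: cvg_monotone_convergence => //.
  - exact: Gm.
  - move=> n; apply/measurable_EFinP.
    by apply: measurable_funTS; exact: measurable_funM.
  - by move=> n w _; rewrite lee_fin mulr_ge0.
  - move=> w _ m n mn; rewrite lee_fin ler_wpM2r//.
    by have /lefP := nd_nnsfun_approx (@measurableT _ (g_sigma_algebraType G)) mEg mn; apply.
have c1 := lim _ mZ1 Z1_ge0; have c2 := lim _ mZ2 Z2_ge0.
rewrite -(cvg_lim _ c1)// -(cvg_lim _ c2)//; apply: lee_lim.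
- by apply/cvg_ex; eexists; exact: c1.
- by apply/cvg_ex; eexists; exact: c2.
- by apply: nearW => n; exact: nnsfun_weight.
Qed.

End weights.

(** * Maximal inequalities of Ville type *)

Section ville.
Context (d : measure_display) (T : measurableType d) (R : realType).
Variables (P : probability T R) (F : nat -> set (set T)).
Hypothesis fF : filtration F.
Variables (L xi : nat -> T -> R).
Hypotheses (mL : forall t, measurable_wrt (F t) (L t))
  (mxi : forall t, measurable_fun setT (xi t)).
Hypotheses (L_ge0 : forall t w, 0 <= L t w) (xi_ge0 : forall t w, 0 <= xi t w).
                                                                              
                   
Hypothesis step : forall t B, F t B ->
  (\int[P]_(w in B) (L t.+1 w)%:E <=
   \int[P]_(w in B) (L t w)%:E + \int[P]_(w in B) (xi t w)%:E)%E.

Let sF t : sigma_algebra setT (F t). Proof. by case: fF. Qed.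
Let Fm t : F t `<=` measurable. Proof. by case: fF. Qed.

Definition crossed (a : R) (n : nat) : set T :=
  [set w | exists2 s, (s <= n)%N & a <= L s w].

Let crossedS a n :
  crossed a n.+1 = crossed a n `|` (~` crossed a n `&` [set w | a <= L n.+1 w]).
Proof.
rewrite setUIr setUCr setTI; apply/seteqP; split=> w /=.
  move=> [s]; rewrite leq_eqVlt ltnS => /orP[/eqP ->|sn] aL; first by right.
  by left; exists s.
by case=> [[s sn aL]|aL]; [exists s => //; exact: leqW|exists n.+1].
Qed.

Let crossed0 a : crossed a 0 = [set w | a <= L 0 w].
Proof.
apply/seteqP; split=> w /=; first by case=> s; rewrite leqn0 => /eqP ->.
by move=> ?; exists 0%N.
Qed.

Let level t a : F t [set w | a <= L t w].
Proof.
have -> : [set w | a <= L t w] = L t @^-1` `[a, +oo[%classic.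
  by apply/seteqP; split=> w /=; rewrite in_itv/= andbT.
exact: mL.
Qed.

Let F_crossed a n : F n (crossed a n).
Proof.
have [_ _ FS] := fF.
elim: n => [|n IHn]; first by rewrite crossed0; exact: level.
rewrite crossedS; apply/(measurable_subsigma (sF _)).
have mn : measurable (crossed a n : set (g_sigma_algebraType (F n.+1))).
  by apply/(measurable_subsigma (sF _)); apply: (FS n).
apply: measurableU => //; apply: measurableI; first exact: measurableC.
by apply/(measurable_subsigma (sF _)); exact: level.
Qed.

Lemma measurable_crossed a n : measurable (crossed a n).
Proof. exact/Fm/F_crossed. Qed.

Let mL' t (D : set T) : measurable_fun D (fun w => (L t w)%:E).
Proof.
apply/measurable_EFinP; apply: measurable_funTS.
exact: (measurable_wrt_fun (@Fm t)).
Qed.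

Let mxi' t (D : set T) : measurable_fun D (fun w => (xi t w)%:E).
Proof. by apply/measurable_EFinP; apply: measurable_funTS. Qed.

Let markov_level (a : R) t (B : set T) : 0 <= a -> measurable B ->
  (a%:E * P (B `&` [set w | (a <= L t w)%R]) +
   \int[P]_(w in B `&` ~` [set w | (a <= L t w)%R]) (L t w)%:E <=
   \int[P]_(w in B) (L t w)%:E)%E.
Proof.
move=> a0 mB; have ml := Fm (@level t a).
have -> : (\int[P]_(w in B) (L t w)%:E =
  \int[P]_(w in B `&` [set w | (a <= L t w)%R]) (L t w)%:E +
  \int[P]_(w in B `&` ~` [set w | (a <= L t w)%R]) (L t w)%:E)%E.
  rewrite -ge0_integral_setU//; last 4 first.
  - exact: measurableI.
  - by apply: measurableI => //; exact: measurableC.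
  - by move=> w _; rewrite lee_fin.
  - apply/eqP; rewrite -subset0 => w /= [[_ ?] [_]]; exact.
  by rewrite -setIUr setUCr setIT.
apply: leeD => //; rewrite -integral_cst//; last exact: measurableI.
by apply: ge0_le_integral => //; [exact: measurableI|move=> w /= [_]; rewrite lee_fin].
Qed.

(** Induction on the process stopped at its first passage above [a]: the remaining integral is the
    mass not yet stopped. In one step it gains at most the drift [xi], and Markov's inequality turns
    the part that has just passed the level into probability. *)
Let ville_stopped (a : R) n : 0 <= a ->
  (a%:E * P (crossed a n) + \int[P]_(w in ~` crossed a n) (L n w)%:E <=
   \int[P]_w (L 0 w)%:E + \sum_(t < n) \int[P]_w (xi t w)%:E)%E.
Proof.
move=> a0; elim: n => [|n IHn].
  rewrite big_ord0 adde0 crossed0.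
  by have := @markov_level a 0%N setT a0 measurableT; rewrite !setTI.
have mc := measurable_crossed a n.
have ml := Fm (@level n.+1 a).
rewrite big_ord_recr/= [leRHS]addeA; apply: le_trans (leeD IHn (lexx _)).
rewrite {1}crossedS measureU//; last 2 first.
- by apply: measurableI => //; exact: measurableC.
- by rewrite -subset0 => w /= [? []].
rewrite ge0_muleDr// -addeA -[leRHS]addeA leeD2l//.
have -> : ~` crossed a n.+1 = ~` crossed a n `&` ~` [set w | a <= L n.+1 w].
  by rewrite crossedS setUIr setUCr setTI setCU.
apply: le_trans (markov_level _ a0 (measurableC mc)) _.
apply: le_trans (step _) _.
  by apply/(measurable_subsigma (sF _)); apply: measurableC;
    apply/(measurable_subsigma (sF _)).
apply: leeD2l; apply: ge0_subset_integral => //; first exact: measurableC.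
by move=> w _; rewrite lee_fin.
Qed.

(** The drift [xi] serves two uses: with [xi] zero this is the supermartingale inequality, and with
    [xi] a truncated square it is a Kolmogorov-type inequality for the truncation argument. *)
Lemma ville (a : R) n : 0 <= a ->
  (a%:E * P (crossed a n) <=
   \int[P]_w (L 0 w)%:E + \sum_(t < n) \int[P]_w (xi t w)%:E)%E.
Proof.
move=> a0; apply: le_trans (ville_stopped n a0).
by rewrite leeDl//; apply: integral_ge0 => w _; rewrite lee_fin.
Qed.

End ville.

Section ville_infinite.
Context (d : measure_display) (T : measurableType d) (R : realType).
Variables (P : probability T R) (F : nat -> set (set T)).
Hypothesis fF : filtration F.
Variables (L : nat -> T -> R).
Hypotheses (mL : forall t, measurable_wrt (F t) (L t)).
Hypotheses (L_ge0 : forall t w, 0 <= L t w).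
Hypothesis step : forall t B, F t B ->
  (\int[P]_(w in B) (L t.+1 w)%:E <= \int[P]_(w in B) (L t w)%:E)%E.

Lemma ville_supermartingale (a : R) : 0 <= a ->
  measurable [set w | exists s, a <= L s w] /\
  (a%:E * P [set w | exists s, (a <= L s w)%R] <= \int[P]_w (L 0 w)%:E)%E.
Proof.
move=> a0.
have E : [set w | exists s, a <= L s w] = \bigcup_n crossed L a n.
  apply/seteqP; split=> w /=; first by case=> s aL; exists s => //; exists s.
  by case=> n _ [s _ aL]; exists s.
have mc n : measurable (crossed L a n) by exact: (measurable_crossed fF mL).
split; first by rewrite E; exact: bigcup_measurable.
have cvg : P (crossed L a n) @[n --> \oo] --> P (\bigcup_n crossed L a n).
  apply: nondecreasing_cvg_mu => //; first exact: bigcup_measurable.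
  move=> m n mn; apply/subsetPset => w [s sm aL]; exists s => //.
  exact: leq_trans mn.
rewrite E; have cvg' := cvgeZl (isT : a%:E \is a fin_num) cvg.
rewrite -(cvg_lim _ cvg')//; apply: lime_le.
  by apply/cvg_ex; eexists; exact: cvg'.
apply: nearW => n.
have int0 (B : set T) : (\int[P]_(w in B) (0 : R)%:E = 0)%E by exact: integral0.
have step0 t B : F t B -> (\int[P]_(w in B) (L t.+1 w)%:E <=
    \int[P]_(w in B) (L t w)%:E + \int[P]_(w in B) (0 : R)%:E)%E.
  by move=> FB; rewrite int0 adde0; exact: step.
have := ville fF mL (fun=> measurable_cst _) L_ge0 (fun _ _ => lexx _) step0 n a0.
by rewrite big1 ?adde0.
Qed.

End ville_infinite.

Section exponential_ville.
Context (d : measure_display) (T : measurableType d) (R : realType).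
Variables (P : probability T R) (F : nat -> set (set T)).
Hypothesis fF : filtration F.
Variables (e p : nat -> T -> R).
Hypotheses (me : forall t, measurable_wrt (F t.+1) (e t))
  (mp : forall t, measurable_wrt (F t) (p t)).
Hypothesis p_ge0 : forall t w, 0 <= p t w.
Hypothesis step : forall t B, F t B ->
  (\int[P]_(w in B) (expR (e t w))%:E <= \int[P]_(w in B) (1 + p t w)%:E)%E.

Let sF t : sigma_algebra setT (F t). Proof. by case: fF. Qed.
Let Fm t : F t `<=` measurable. Proof. by case: fF. Qed.

Let L t w := expR (\sum_(i < t) (e i w - p i w)).

Let mS t : measurable_wrt (F t) (fun w => \sum_(i < t) (e i w - p i w)).
Proof.
have [_ _ FS] := fF.
elim: t => [|t IH].
  rewrite (_ : (fun w => _) = cst 0); last first.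
    by apply/funext => w; rewrite big_ord0.
  exact: measurable_wrt_cst.
rewrite (_ : (fun w => _) =
    (fun w => \sum_(i < t) (e i w - p i w) + (e t w - p t w))); last first.
  by apply/funext => w; rewrite big_ord_recr.
apply: measurable_wrtD => //; first exact: measurable_wrtS (FS _ _ (leqnSn t)) IH.
apply: measurable_wrtB => //.
exact: measurable_wrtS (FS _ _ (leqnSn t)) (mp t).
Qed.

(** The exponential [L] of the partial sums is a supermartingale because $(1+p)e^{-p}\le 1$. The
    event ranges over all times at once, so no time horizon enters the law of the iterated
    logarithm. *)
Lemma exponential_ville (a : R) :
  measurable [set w | exists n, a <= \sum_(i < n) (e i w - p i w)] /\
  (P [set w | exists n, (a <= \sum_(i < n) (e i w - p i w))%R]
     <= (expR (- a))%:E)%E.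
Proof.
have mL t : measurable_wrt (F t) (L t).
  by apply: measurable_wrt_comp => //; exact: measurable_expR.
have Lstep t B : F t B ->
    (\int[P]_(w in B) (L t.+1 w)%:E <= \int[P]_(w in B) (L t w)%:E)%E.
  move=> FB.
  (* The part of [L t.+1] known at time [t]; it is the weight against which the hypothesis [step] is
     integrated. *)
  pose g w := L t w * expR (- p t w).
  have mg : measurable_wrt (F t) g.
    apply: measurable_wrtM => //.
    apply: (measurable_wrt_comp (sF t) (@measurable_expR R)).
    exact: (measurable_wrt_comp (sF t) (@oppr_measurable R setT)).
  have me' : measurable_fun setT (fun w => expR (e t w)).
    exact: (measurableT_comp (@measurable_expR R)
      (measurable_wrt_fun (@Fm t.+1) (me t))).
  have mp' : measurable_fun setT (fun w => 1 + p t w).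
    apply: measurable_funD; first exact: measurable_cst.
    exact: (measurable_wrt_fun (@Fm t) (mp t)).
  have := weighted_integral_le (sF t) (@Fm t) me' mp' _ _ (step (t := t)) mg _ FB.
  move=> le1; apply: (@le_trans _ _ (\int[P]_(w in B) (g w * expR (e t w))%:E)%E).
    rewrite le_eqVlt; apply/orP; left; apply/eqP; apply: eq_integral => w _.
    by rewrite /g /L big_ord_recr/= -!expRD; congr (expR _)%:E; ring.
  apply: (@le_trans _ _ (\int[P]_(w in B) (g w * (1 + p t w))%:E)%E).
    apply: le1 => w; first exact: expR_ge0.
      by rewrite addr_ge0.
    by rewrite mulr_ge0// expR_ge0.
  have mg' := measurable_wrt_fun (@Fm t) mg.
  apply: ge0_le_integral.
  - exact: (@Fm t).
  - by move=> w _; rewrite lee_fin !mulr_ge0 ?expR_ge0// addr_ge0.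
  - by apply/measurable_EFinP; apply: measurable_funTS; exact: measurable_funM.
  - apply/measurable_EFinP; apply: measurable_funTS.
    exact: (measurable_wrt_fun (@Fm t) (mL t)).
  - move=> w _; rewrite lee_fin /g -mulrA ger_pMr ?expR_gt0//.
    by rewrite expRN mulrC ler_pdivrMr ?expR_gt0// mul1r expR_ge1Dx.
have [mE le] := ville_supermartingale fF mL (fun _ _ => expR_ge0 _) Lstep (expR_ge0 a).
have E : [set w | exists n, a <= \sum_(i < n) (e i w - p i w)] =
    [set w | exists n, expR a <= L n w].
  by apply/seteqP; split=> w /= [n]; rewrite ?ler_expR => le'; exists n;
    rewrite ?ler_expR.
rewrite E; split => //.
rewrite expRN -[leRHS]mule1 lee_pdivlMl ?expR_gt0//.
apply: le_trans le _; under eq_integral do rewrite /L big_ord0 expR0.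
by rewrite integral_cst// mul1e probability_le1.
Qed.

End exponential_ville.

                                                 

(** * Two elementary facts on the exponential *)

Section real_analysis.
Context {R : realType}.
Implicit Types x y h : R.

                                                               
(** The quotient [g] of the two sides has derivative of the sign of $x^3$, hence minimum $g(0)=1$.
    The coefficients satisfy $1/6+1/3=1/2$, the Gaussian rate, so no constant is lost once squares
    are compared with conditional variances. *)
Lemma expR_le_quadratic y : expR (y - y ^+ 2 / 6) <= 1 + y + y ^+ 2 / 3.
Proof.
pose g x : R := (1 + x + x ^+ 2 / 3) * expR (x ^+ 2 / 6 - x).
pose g' x : R := expR (x ^+ 2 / 6 - x) * x ^+ 3 / 9.
have dg x : is_derive x 1 g (g' x).
  rewrite /g /g'; apply: is_derive_eq.
  by rewrite /GRing.scale/=; field.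
have cg a b : {within `[a, b], continuous g}.
  apply: derivable_within_continuous => x _.
  by have [] := dg x.
have g0 : g 0 = 1 by rewrite /g expr0n/= !mul0r subr0 expR0 !addr0 mulr1.
have gy : 1 <= g y.
  case: (leP 0 y) => y0.
    have [c] := MVT_segment y0 (fun x _ => dg x) (cg _ _).
    rewrite in_itv/= => /andP[c0 _]; rewrite g0 => /eqP; rewrite subr_eq => /eqP ->.
    by rewrite lerDr subr0 !mulr_ge0 ?expR_ge0 ?exprn_ge0.
  have [c] := MVT_segment (ltW y0) (fun x _ => dg x) (cg _ _).
  rewrite in_itv/= => /andP[_ c0]; rewrite g0 sub0r => E.
  have g'c : g' c <= 0.
    rewrite /g' pmulr_lle0 ?invr_gt0// pmulr_rle0 ?expR_gt0//.
    by rewrite exprn_odd_le0.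
  by nra.
have e0 := expR_gt0 (y - y ^+ 2 / 6).
rewrite -(@ler_pM2r _ (expR (y - y ^+ 2 / 6))) // mul1r in gy.
apply: le_trans gy _; rewrite /g -mulrA -expRD.
by rewrite [X in expR X](_ : _ = 0) ?expR0 ?mulr1//; ring.
Qed.

(** Exponents are powers of two because the matrix Jensen inequality [qform_pow2_le] is proved for
    those. *)
Lemma one_plus_pow_expR y : 
  (fun m => (1 + y / (2 ^ m)%:R) ^+ (2 ^ m)) @ \oo --> expR y.
Proof.
have t0 : (fun m => y / (2 ^ m)%:R) @ \oo --> (0 : R).
  rewrite (_ : (fun m => _) = (fun m => y * 2^-1 ^+ m)); last first.
    by apply/funext => m; rewrite natrX exprVn.
  by apply: cvg_geometric; rewrite ger0_norm ?invr_lt1 ?ltr1n ?unitfE.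
(* With $t=y/n$, the bounds $t/(1+t)\le\ln(1+t)\le t$ squeeze the power between this exponential and
   $e^y$. *)
have lb : (fun m => expR (y / (1 + y / (2 ^ m)%:R))) @ \oo --> expR y.
  have H : (fun m => y / (1 + y / (2 ^ m)%:R)) @ \oo --> y.
    rewrite -[X in _ --> X](divr1 y) -[X in _ / X](addr0 1).
    apply: cvgMl_tmp; apply: cvgV; first by rewrite addr0 oner_neq0.
    by apply: cvgD => //; exact: cvg_cst.
  exact: (cvg_comp _ _ H (@continuous_expR R y)).
apply: (squeeze_cvgr _ lb (cvg_cst (expR y))).
have : \forall m \near \oo, `|y / (2 ^ m)%:R| < 1.
  by move/cvgr0_norm_lt: t0; apply; exact: ltr01.
apply: filterS => m; set n := (2 ^ m)%N; set t := y / n%:R.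
rewrite ltr_norml => /andP[t1 _].
have n0 : (0 : R) < n%:R by rewrite ltr0n expn_gt0.
have t1' : 0 < 1 + t by lra.
have -> : y = n%:R * t by rewrite /t mulrC divfK// gt_eqF.
rewrite -mulrA !expRM_natl !lerXn2r ?nnegrE ?expR_ge0 ?(ltW t1') ?expR_ge1Dx//.
rewrite -[leRHS]lnK ?posrE// ler_expR -[leRHS]opprK -lnV ?posrE//.
have E : 1 + - (t / (1 + t)) = (1 + t)^-1 by field; rewrite gt_eqF.
rewrite lerNr; have := @le_ln1Dx R (- (t / (1 + t))); rewrite E; apply.
by rewrite ltrNl opprK ltr_pdivrMr// mul1r; lra.
Qed.

End real_analysis.

(** * Borel-Cantelli and the scalar upper law from exponential tails *)

Section borel_cantelli.
Context (d : measure_display) (T : measurableType d) (R : realType).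
Variable P : probability T R.

Lemma ae_eventually_not (E : nat -> set T) (C : R) :
  (forall k, measurable (E k)) ->
  (forall K, \sum_(k < K) P (E k) <= C%:E)%E ->
  {ae P, forall w, exists K, forall k, (K <= k)%N -> ~ E k w}.
Proof.
move=> mE sE.
have E0 : P (lim_sup_set E) = 0%E.
  apply: lim_sup_set_cvg0 => //.
  apply: (@le_lt_trans _ _ C%:E); last exact: ltry.
  apply: lime_le; first exact: is_cvg_nneseries.
  by apply: nearW => n; rewrite big_mkord; exact: sE.
exists (lim_sup_set E); split => //.
  by apply: bigcap_measurable => // k _; exact: bigcup_measurable.
move=> w /= /asboolP; rewrite asbool_neg => /negP nw.
move=> K _; apply: contrapT => nK; apply: nw; apply/asboolP.
by exists K => k Kk Ek; apply: nK; exists k.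
Qed.

End borel_cantelli.

Section upper_lil.
Context (d : measure_display) (T : measurableType d) (R : realType).
Variable P : probability T R.

(** The terms are $x^{-(1+\varepsilon)}$ along an arithmetic progression of step $h$. This is the
    integral test in discrete form: each term is dominated by a difference of values of
    $x^{-\varepsilon}$, and the differences telescope. *)
Lemma sum_expR_ln_le (eps h : R) (K : nat) : 0 < eps -> 0 < h ->
  \sum_(k < K) expR (- ((1 + eps) * ln (k.+2%:R * h))) <=
  expR (- (eps * ln h)) / (eps * h).
Proof.
move=> e0 h0; have eh0 : 0 < eps * h by rewrite mulr_gt0.
pose phi k := expR (- (eps * ln (k.+1%:R * h))).
suff : \sum_(k < K) expR (- ((1 + eps) * ln (k.+2%:R * h))) <=
    (phi 0 - phi K) / (eps * h).
  move=> /le_trans; apply; rewrite ler_pM2r ?invr_gt0// /phi mul1r.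
  by rewrite gerBl expR_ge0.
elim: K => [|K IH]; first by rewrite big_ord0 subrr mul0r.
rewrite big_ord_recr/=.
suff step : expR (- ((1 + eps) * ln (K.+2%:R * h))) <= (phi K - phi K.+1) / (eps * h).
  apply: le_trans (lerD IH step) _.
  by rewrite -mulrDl addrA subrK.
rewrite ler_pdivlMr//.
set x := K.+2%:R * h; have x0 : 0 < x by rewrite mulr_gt0.
have y0 : 0 < K.+1%:R * h by rewrite mulr_gt0.
have -> : expR (- ((1 + eps) * ln x)) = phi K.+1 / x.
  by rewrite -[x in _ / x]lnK ?posrE// -expRN -expRD /phi; congr expR; ring.
have -> : phi K = phi K.+1 * expR (eps * (ln x - ln (K.+1%:R * h))).
  by rewrite /phi -expRD; congr expR; rewrite -/x; ring.
rewrite -[X in _ <= _ - X]mulr1 -mulrBr -mulrA ler_pM2l ?expR_gt0//.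
apply: (@le_trans _ _ (eps * (ln x - ln (K.+1%:R * h)))); last first.
  by rewrite lerBrDl expR_ge1Dx.
rewrite mulrCA ler_pM2l// -ln_div ?posrE//.
have E : (K.+1%:R * h) / x = 1 - h / x.
  by rewrite /x -[in LHS](natr1 K.+1) -natr1; field; rewrite gt_eqF//= natr1 natr1 pnatr_eq0.
rewrite -[leRHS]opprK lerNr -lnV ?posrE ?divr_gt0// invf_div E mulrC.
apply: le_ln1Dx; rewrite ltrNl opprK mulrC ltr_pdivrMr// mul1r /x.
by rewrite ltr_pMl// ltr1n.
Qed.

Variables (M A : nat -> T -> R) (c : R).
Hypothesis c_ge0 : 0 <= c.

Let psi (l : R) := l ^+ 2 / 2 / (1 - l * c).

Hypothesis exp_tail : forall l a : R, 0 < l -> l * c < 1 ->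
  measurable [set w | exists t, a <= l * M t w - psi l * A t w] /\
  (P [set w | exists t, (a <= l * M t w - psi l * A t w)%R] <= (expR (- a))%:E)%E.

(** Peeling along deterministic slices of [v]. The bound is stated for every [v] dominating the
    clock [A t w], so the clock of one direction can later be replaced by the common [V]. *)
Lemma upper_lil (eps : R) : 0 < eps -> eps <= 1 ->
  {ae P, forall w, exists v0, forall t v, v0 <= v -> A t w <= v ->
    M t w <= (1 + eps) * Num.sqrt (2 * v * ln (ln v))}.
Proof.
move=> e0 e1.
pose h := eps / 8; have h0 : 0 < h by rewrite divr_gt0.
                                                                       
(* Slice [k] holds the [v] with $x_k\le\ln v<x_k+h$, so [ln (x k)] is the iterated logarithm of its
   left end. The value [lam k] minimises $lv/2+\ln(x_k)/l$ at that left end. *)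
pose x k : R := k.+2%:R * h.
pose lam k := Num.sqrt (2 * ln (x k) / expR (x k)).
pose E k := [set w | exists t, (1 + eps) * ln (x k) <=
  lam k * M t w - psi (lam k) * A t w].
(* By $\ln x\le x$ and $e^x\ge x^2/2$, the condition [lam k * c <= eps / 8] follows from
   $2xc^2\le(\varepsilon/8)^2x^2/2$, which is $x\ge 256c^2/\varepsilon^2$. The bound 3 makes
   [ln (x k)] positive. *)
pose thr := Num.max 3 (256 * c ^+ 2 / eps ^+ 2).
have x_gt0 k : 0 < x k by rewrite mulr_gt0.
have thr_x k : thr <= x k ->
    [/\ 1 < x k, 0 < ln (x k), 0 < lam k & lam k * c <= eps / 8].
  rewrite ge_max => /andP[x3 xc].
  have x1 : 1 < x k by apply: lt_le_trans x3; rewrite ltr1n.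
  have ln0 : 0 < ln (x k) by rewrite ln_gt0.
  have lam0 : 0 < lam k by rewrite sqrtr_gt0 divr_gt0 ?expR_gt0// mulr_gt0.
  split => //.
  have l2 : lam k ^+ 2 = 2 * ln (x k) / expR (x k).
    by rewrite sqr_sqrtr// divr_ge0 ?expR_ge0// mulr_ge0// ltW.
  rewrite -(@ler_pXn2r _ 2) ?nnegrE ?mulr_ge0 ?(ltW lam0) ?divr_ge0 ?(ltW e0)//.
  rewrite exprMn l2 mulrAC ler_pdivrMr ?expR_gt0//.
  have ex : x k ^+ 2 / 2 <= expR (x k).
    have := @expR_ge1Dxn R (x k) 1 (ltW (x_gt0 k)).
    by rewrite (_ : 2`! = 2)%N//; lra.
  have lx := ltW (ln_sublinear (x_gt0 k)).
  have c2 : 0 <= c ^+ 2 by rewrite exprn_ge0.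
  have e2 : 0 < eps ^+ 2 by rewrite exprn_gt0.
  rewrite ler_pdivrMr// in xc.
  apply: (@le_trans _ _ (2 * x k * c ^+ 2)).
    by rewrite ler_wpM2r// ler_pM2l.
  apply: (@le_trans _ _ ((eps / 8) ^+ 2 * (x k ^+ 2 / 2))); last first.
    by rewrite ler_pM2l// exprn_gt0// divr_gt0.
  have := x_gt0 k; move: xc; set X := x k; set C := c ^+ 2; rewrite expr_div_n.
  by move=> xc X0; nra.
(* The finitely many early slices, where [lam k * c < 1] is not guaranteed, are discarded. *)
pose E' k := if thr <= x k then E k else set0.
have EP k : measurable (E' k) /\
    (P (E' k) <= (expR (- ((1 + eps) * ln (x k))))%:E)%E.
  rewrite /E'; case: ifPn => [/thr_x[_ _ l0 lc]|_].
    apply: exp_tail => //; apply: le_lt_trans lc _.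
    by rewrite ltr_pdivrMr// mul1r (le_lt_trans e1)// ltr1n.
  by split=> //; rewrite measure0 lee_fin expR_ge0.
have : {ae P, forall w, exists K, forall k, (K <= k)%N -> ~ E' k w}.
  apply: (ae_eventually_not (C := expR (- (eps * ln h)) / (eps * h))).
    by move=> k; have [] := EP k.
  move=> K; apply: le_trans (_ : (\sum_(k < K) (expR (- ((1 + eps) * ln (x k))))%:E <= _)%E).
    by apply: lee_sum => k _; have [] := EP k.
  by rewrite sumEFin lee_fin; exact: sum_expR_ln_le.
apply: filterS => w [K nE].
exists (expR (Num.max thr (x K.+1) + h)) => t v v0v Av.
have v0 : 0 < v by apply: lt_le_trans v0v; exact: expR_gt0.
have lv : Num.max thr (x K.+1) + h <= ln v by rewrite -ler_expR lnK ?posrE.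
have /andP[lt lx] : (thr + h <= ln v) && (x K.+1 + h <= ln v).
  by rewrite -!lerBrDr -ge_max lerBrDr.
(* Selects the slice containing [v]; its index is [k] with [n = k.+2]. *)
pose n := Num.truncn (ln v / h).
have lnv_ge0 : 0 <= ln v by apply: le_trans lx; rewrite addr_ge0 ?(ltW h0) ?(ltW (x_gt0 _)).
have /andP[n1 n2] : n%:R <= ln v / h < n.+1%:R.
  by apply: truncn_itv; rewrite divr_ge0// ltW.
rewrite ler_pdivlMr// in n1; rewrite ltr_pdivrMr// in n2.
have Kn : (K.+2 < n)%N.
  rewrite -ltnS -(ltr_nat R) -(ltr_pM2r h0); apply: le_lt_trans n2.
  by apply: le_trans lx; rewrite lerDl ltW.
have [k nk] : exists k, n = k.+2.
  by exists n.-2; move: Kn; case: (n) => [|[]].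
rewrite {}nk {n} in n1 n2 Kn.
have thrk : thr <= x k.
  move: n2; rewrite -natr1 mulrDl mul1r => n2; rewrite /x.
  by rewrite -(lerD2r h) (le_trans lt)// ltW.
have [x1 ln0 lam0 lc] := thr_x _ thrk.
have : ~ E' k w by apply: nE; apply: ltnW.
rewrite /E' thrk => nEk.
have {nEk}lt1 : lam k * M t w - psi (lam k) * A t w < (1 + eps) * ln (x k).
  by rewrite ltNge; apply/negP => H; apply: nEk; exists t.
set L := ln (x k) in ln0 lt1 *.
have eh : expR h <= 1 + eps / 4.
  have : expR (- h) >= 1 - h by exact: expR_ge1Dx.
  have := expR_gt0 h; rewrite expRN => eh0.
  have -> : eps / 4 = 2 * h by rewrite /h; field.
  have h1 : h <= 1 / 2 by rewrite /h; lra.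
  rewrite -[_^-1]div1r ler_pdivlMr// => H.
  have : (1 - h) * expR h <= (1 - h) * (1 + 2 * h) by nra.
  by rewrite ler_pM2l//; lra.
have vx : v <= expR h * expR (x k).
  rewrite -expRD -[leLHS]lnK ?posrE// ler_expR ltW//.
  by move: n2; rewrite -natr1 mulrDl mul1r addrC.
have d0 : 0 < 1 - lam k * c by lra.
have psi0 : 0 <= psi (lam k).
  by rewrite /psi divr_ge0 ?(ltW d0)// divr_ge0// exprn_ge0// ltW.
have l2 : lam k ^+ 2 = 2 * L / expR (x k).
  by rewrite sqr_sqrtr// divr_ge0 ?expR_ge0// mulr_ge0// ltW.
(* At the left end the product [psi (lam k) * expR (x k)] equals [L / (1 - lam k * c)]. The slice
   width and the denominator each cost a factor at most [1 + eps / 4], and their product is at most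
   [1 + eps]. *)
have psiv : psi (lam k) * v <= (1 + eps / 4) ^+ 2 * L.
  apply: (@le_trans _ _ (psi (lam k) * (expR h * expR (x k)))).
    by rewrite ler_wpM2l.
  have -> : psi (lam k) * (expR h * expR (x k)) = expR h * (L / (1 - lam k * c)).
    by rewrite /psi l2; field; rewrite !gt_eqF ?expR_gt0.
  rewrite expr2 -mulrA; apply: ler_pM; rewrite ?expR_ge0 ?divr_ge0 ?(ltW ln0) ?(ltW d0)//.
  rewrite ler_pdivrMr// mulrAC ler_peMl ?(ltW ln0)//; nra.
have lamM : lam k * M t w <= 2 * (1 + eps) * L.
  have : psi (lam k) * A t w <= psi (lam k) * v by rewrite ler_wpM2l.
  have : (1 + eps / 4) ^+ 2 * L <= (1 + eps) * L by rewrite ler_pM2r//; nra.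
  by lra.
have lams : lam k * Num.sqrt (2 * expR (x k) * L) = 2 * L.
  rewrite -sqrtrM ?divr_ge0 ?expR_ge0 ?mulr_ge0 ?(ltW ln0)//.
  have -> : 2 * ln (x k) / expR (x k) * (2 * expR (x k) * L) = (2 * L) ^+ 2.
    by rewrite /L; field; rewrite gt_eqF ?expR_gt0.
  by rewrite sqrtr_sqr ger0_norm// mulr_ge0// ltW.
have {lamM lams} : M t w <= (1 + eps) * Num.sqrt (2 * expR (x k) * L).
  by rewrite -(ler_pM2l lam0) mulrCA lams; lra.
move=> /le_trans; apply; rewrite ler_pM2l; last lra.
have xv : expR (x k) <= v by rewrite -[leRHS]lnK ?posrE// ler_expR.
apply: ler_wsqrtr; apply: ler_pM; rewrite ?mulr_ge0 ?expR_ge0 ?(ltW ln0)//.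
  by rewrite ler_pM2l.
rewrite /L ler_ln ?posrE//; apply: lt_le_trans (x_gt0 k) _; exact: n1.
Qed.

End upper_lil.

                                                    

(** * Inequalities between conditional expectations *)

Section conditional_order.
Context (d : measure_display) (T : measurableType d) (R : realType).
Variables (P : probability T R) (G : set (set T)).
Hypothesis Gm : G `<=` measurable.
Implicit Types f g : T -> R.

                                                                    
(** Expresses $\mathbb{E}[f\mid G]\le\mathbb{E}[g\mid G]$ through integrals over the sets of [G], so
    that conditional expectations need not be constructed. Equality is expressed by the two opposite
    relations. *)
Definition cond_le f g :=
  [/\ P.-integrable setT (EFin \o f), P.-integrable setT (EFin \o g) &
      forall B, G B ->
        (\int[P]_(w in B) (f w)%:E <= \int[P]_(w in B) (g w)%:E)%E].

Lemma cond_leW f g : P.-integrable setT (EFin \o f) ->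
  P.-integrable setT (EFin \o g) -> (forall w, f w <= g w) -> cond_le f g.
Proof.
move=> f_int g_int fg; split => // B /Gm mB; apply: le_integral => //.
- exact: integrableS f_int.
- exact: integrableS g_int.
- by move=> w _; rewrite lee_fin.
Qed.

Lemma cond_le_refl f : P.-integrable setT (EFin \o f) -> cond_le f f.
Proof. by move=> f_int; apply: cond_leW. Qed.

Lemma cond_le_cst (c : R) : cond_le (cst c) (cst c).
Proof. by apply: cond_le_refl; exact: finite_measure_integrable_cst. Qed.

Lemma cond_le_trans g f h : cond_le f g -> cond_le g h -> cond_le f h.
Proof.
move=> [f_int _ fg] [_ h_int gh]; split=> // B GB.
exact: le_trans (fg _ GB) (gh _ GB).
Qed.

Lemma cond_leD f1 f2 g1 g2 : cond_le f1 g1 -> cond_le f2 g2 ->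
  cond_le (fun w => f1 w + f2 w) (fun w => g1 w + g2 w).
Proof.
move=> [f1i g1i le1] [f2i g2i le2]; split.
- exact: (integrableD measurableT f1i f2i).
- exact: (integrableD measurableT g1i g2i).
- move=> B GB; have mB := Gm GB.
  have iB f : P.-integrable setT (EFin \o f) -> P.-integrable B (EFin \o f).
    exact: integrableS.
  rewrite (integralD mB (iB _ f1i) (iB _ f2i)) (integralD mB (iB _ g1i) (iB _ g2i)).
  by apply: leeD; [exact: le1|exact: le2].
Qed.

Lemma cond_leZ (a : R) f g : 0 <= a -> cond_le f g ->
  cond_le (fun w => a * f w) (fun w => a * g w).
Proof.
move=> a0 [fi gi le]; split.
- exact: (integrableZl measurableT a fi).
- exact: (integrableZl measurableT a gi).
- move=> B GB; have mB := Gm GB.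
  have iB h : P.-integrable setT (EFin \o h) -> P.-integrable B (EFin \o h).
    exact: integrableS.
  rewrite (integralZl mB (iB _ fi)) (integralZl mB (iB _ gi)).
  by apply: lee_wpmul2l; [rewrite lee_fin|exact: le].
Qed.

Lemma cond_leN f g : cond_le f g -> cond_le (fun w => - g w) (fun w => - f w).
Proof.
move=> fg; have [fi gi _] := fg.
have : cond_le (fun w => - f w - g w) (fun w => - f w - g w).
  apply: cond_le_refl; have := integrableD measurableT fi gi.
  move=> /(integrableZl measurableT (-1)); apply: eq_integrable => // w _ /=.
  by rewrite -EFinD -EFinM mulN1r opprD.
move=> /(cond_leD fg); rewrite [X in cond_le X](_ : _ = (fun w => - g w)); last first.
  by apply/funext => w; ring.
rewrite [X in cond_le _ X](_ : _ = (fun w => - f w))//.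
by apply/funext => w; ring.
Qed.

Lemma cond_leZ_eq (a : R) f g : cond_le f g -> cond_le g f ->
  cond_le (fun w => a * f w) (fun w => a * g w).
Proof.
move=> fg gf; have [a0|a0] := leP 0 a; first exact: cond_leZ.
have a0' : 0 <= - a by rewrite oppr_ge0 ltW.
have := cond_leN (cond_leZ a0' gf).
by under eq_fun do rewrite mulNr opprK;
   under [X in cond_le _ X]eq_fun do rewrite mulNr opprK.
Qed.

Lemma cond_le_sum (I : Type) (s : seq I) (f g : I -> T -> R) :
  (forall i, cond_le (f i) (g i)) ->
  cond_le (fun w => \sum_(i <- s) f i w) (fun w => \sum_(i <- s) g i w).
Proof.
move=> fg; elim: s => [|i s IH].
  by under eq_fun do rewrite big_nil;
     under [X in cond_le _ X]eq_fun do rewrite big_nil; exact: cond_le_cst.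
under eq_fun do rewrite big_cons; under [X in cond_le _ X]eq_fun do rewrite big_cons.
exact: cond_leD.
Qed.

End conditional_order.

(** * Quadratic forms of matrix powers *)

Section quadratic_form.
Context {R : realType} (n : nat).
Implicit Types (u : 'rV[R]_n) (A B X : 'M[R]_n).

Definition qform u A : R := (u *m A *m u^T) 0 0.

Lemma qformE u A : qform u A = \sum_i \sum_j u 0 i * u 0 j * A i j.
Proof.
rewrite /qform mxE exchange_big/=; apply: eq_bigr => j _.
rewrite !mxE mulr_suml; apply: eq_bigr => i _; by rewrite mulrAC.
Qed.

Lemma qformD u A B : qform u (A + B) = qform u A + qform u B.
Proof. by rewrite /qform mulmxDr mulmxDl mxE. Qed.

Lemma qformB u A B : qform u (A - B) = qform u A - qform u B.
Proof. by rewrite /qform mulmxBr mulmxBl !mxE. Qed.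

Lemma qformZ u (a : R) A : qform u (a *: A) = a * qform u A.
Proof. by rewrite /qform -scalemxAr -scalemxAl mxE. Qed.

Lemma qform_sum u (I : Type) (s : seq I) (A : I -> 'M[R]_n) :
  qform u (\sum_(i <- s) A i) = \sum_(i <- s) qform u (A i).
Proof.
elim: s => [|i s IH]; last by rewrite !big_cons qformD IH.
by rewrite !big_nil /qform mulmx0 mul0mx mxE.
Qed.

Lemma qform1 u : qform u 1 = \sum_i u 0 i ^+ 2.
Proof.
rewrite /qform [1]/(1%:M) mulmx1 mxE.
by apply: eq_bigr => i _; rewrite mxE.
Qed.

Lemma qform1_ge0 u : 0 <= qform u 1.
Proof. by rewrite qform1 sumr_ge0// => i _; exact: sqr_ge0. Qed.

Lemma qform_sqr u X : X^T = X -> qform u (X ^+ 2) = qform (u *m X) 1.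
Proof.
move=> sX; rewrite /qform expr2 -[X * X]/(X *m X) trmx_mul sX.
by rewrite -[1]/(1%:M) mulmx1 !mulmxA.
Qed.

Lemma trmx_exp X k : X^T = X -> (X ^+ k)^T = X ^+ k.
Proof.
move=> sX; elim: k => [|k IH]; first by rewrite expr0 trmx1.
by rewrite [in LHS]exprS [LHS]trmx_mul IH sX exprSr.
Qed.

Lemma qform_even_ge0 u X k : X^T = X -> 0 <= qform u (X ^+ k.*2).
Proof.
move=> sX; rewrite -muln2 exprM qform_sqr ?qform1_ge0//.
exact: trmx_exp.
Qed.

Lemma qform_shift_sqr u X (a : R) : X^T = X ->
  0 <= qform u (X ^+ 2) + 2 * a * qform u X + a ^+ 2 * qform u 1.
Proof.
move=> sX; have : 0 <= qform u ((X + a%:M) ^+ 2).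
  by rewrite qform_sqr ?qform1_ge0// linearD/= sX tr_scalar_mx.
have -> : (X + a%:M) ^+ 2 = X ^+ 2 + (a *+ 2) *: X + a ^+ 2 *: (1 : 'M[R]_n).
  rewrite expr2 mulrDl !mulrDr.
  rewrite -[X * a%:M]/(X *m a%:M) -[a%:M * X]/(a%:M *m X) mul_mx_scalar mul_scalar_mx.
  rewrite -[a%:M * a%:M]/(a%:M *m a%:M) -scalar_mxM scalemx1 -!expr2.
  by rewrite mulr2n scalerDl !addrA.
by rewrite !qformD !qformZ [2 * a]mulr_natl.
Qed.

Lemma qform_sqr_le u X : X^T = X -> qform u 1 = 1 ->
  qform u X ^+ 2 <= qform u (X ^+ 2).
Proof.
move=> sX u1; have := qform_shift_sqr u (- qform u X) sX.
by rewrite u1; nra.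
Qed.

                                                                            
(** Jensen's inequality without diagonalisation: apply [qform_sqr_le] to [X], then the induction
    hypothesis to its square. Raising to a power preserves the order because both sides of
    [qform_sqr_le] are nonnegative. *)
Lemma qform_pow2_le u X m : X^T = X -> qform u 1 = 1 ->
  qform u X ^+ (2 ^ m) <= qform u (X ^+ (2 ^ m)).
Proof.
move=> + u1; elim: m X => [|m IH] X sX; first by rewrite expn0 !expr1.
rewrite expnS !exprM; apply: le_trans (IH _ (trmx_exp 2 sX)).
by rewrite lerXn2r ?nnegrE ?sqr_ge0 ?qform_sqr_le// -[2%N]/(1.*2) qform_even_ge0.
Qed.

(** The matrix form of $|x|\le(c+x^2/c)/2$ multiplied by $x^{2j}$: positivity of $(X\pm c)^2$ is
    tested on the vector [u *m X ^+ j]. *)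
Lemma qform_odd_le u X j (c : R) : 0 < c -> X^T = X ->
  `|qform u (X ^+ j.*2.+1)| <=
    (c * qform u (X ^+ j.*2) + c^-1 * qform u (X ^+ j.*2.+2)) / 2.
Proof.
move=> c0 sX; have sXj := trmx_exp j sX.
have shift i : qform (u *m X ^+ j) (X ^+ i) = qform u (X ^+ (j.*2 + i)).
  rewrite /qform trmx_mul sXj !mulmxA -addnn addnAC !exprD.
  by rewrite -![_ ^+ _ * _]/(_ *m _) !mulmxA.
                                                             
have := qform_shift_sqr (u *m X ^+ j) c sX.
have := qform_shift_sqr (u *m X ^+ j) (- c) sX.
have := shift 0%N; have := shift 1%N; have := shift 2%N.
rewrite addn0 addn1 addn2 expr1 expr0 => -> -> ->.
set p := qform u (X ^+ j.*2); set q := qform u (X ^+ j.*2.+1).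
set r := qform u (X ^+ j.*2.+2) => l1 l2.
have -> : (c * p + c^-1 * r) / 2 = (c ^+ 2 * p + r) / (2 * c).
  by field; rewrite gt_eqF.
by rewrite ler_norml ler_pdivlMr ?mulr_gt0// lerNl ler_pdivlMr ?mulr_gt0//; nra.
Qed.

End quadratic_form.

(** * Exponential moments under the Bernstein condition *)

Lemma fact_bernstein_le (j : nat) : (0 < j)%N ->
  ((j.*2)`! + (j.*2.+2)`! <= 2 * (j.*2.+1)`! * 3 ^ (j.*2).-1)%N.
Proof.
case: j => // j _; rewrite (factS j.+1.*2.+1) (factS j.+1.*2).
set f := (j.+1.*2)`!.
(* What remains after the factorials are factored out. At the smallest index it reads 5 <= 6, whence
   the factor 3 in [3 * c] below. *)
have le : (j.+1.*2.+3 <= 2 * 3 ^ (j.+1.*2).-1)%N.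
  elim: j {f} => [|j IH]; first by [].
  rewrite doubleS (_ : (j.+1.*2.+2).-1 = ((j.+1.*2).-1).+2); last by rewrite doubleS.
  by rewrite expnS expnS; lia.
apply: (@leq_trans (j.+1.*2.+3 * (j.+1.*2.+1 * f))); first by lia.
by rewrite [leqRHS]mulnAC leq_mul2r le orbT.
Qed.

Section bernstein.
Context (d : measure_display) (T : measurableType d) (R : realType).
Variables (P : probability T R) (G : set (set T)).
Hypothesis Gm : G `<=` measurable.
Variables (n : nat) (X : T -> 'M[R]_n) (u : 'rV[R]_n) (v : T -> R) (c : R).
Hypotheses (c_gt0 : 0 < c) (sX : forall w, (X w)^T = X w) (u1 : qform u 1 = 1).
Hypothesis v_ge0 : forall w, 0 <= v w.
Hypothesis mean_le0 : cond_le P G (fun w => qform u (X w)) (cst 0).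
Hypothesis mean_ge0 : cond_le P G (cst 0) (fun w => qform u (X w)).
Hypothesis moments : forall k, (2 <= k)%N ->
  cond_le P G (fun w => qform u (X w ^+ k))
              (fun w => (k`!%:R / 2 * c ^+ (k - 2)) * v w).

Let integrable_scale (a : R) f : P.-integrable setT (EFin \o f) ->
  P.-integrable setT (EFin \o (fun w => a * f w)).
Proof. by move=> fi; exact: (integrableZl measurableT a fi). Qed.

Let integrable_add f g : P.-integrable setT (EFin \o f) ->
  P.-integrable setT (EFin \o g) ->
  P.-integrable setT (EFin \o (fun w => f w + g w)).
Proof. by move=> fi gi; exact: (integrableD measurableT fi gi). Qed.

Let v_int : P.-integrable setT (EFin \o v).
Proof.
have [_ + _] := moments (leqnn 2).
apply: eq_integrable => // w _ /=; congr EFin.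
by rewrite subnn expr0 mulr1 (_ : 2`! = 2)%N// divff// mul1r.
Qed.

Let moment_int k : P.-integrable setT (EFin \o (fun w => qform u (X w ^+ k))).
Proof.
case: k => [|[|k]]; last by have [] := moments (isT : 2 <= k.+2)%N.
  apply: (eq_integrable measurableT (EFin \o cst 1)).
    by move=> w _ /=; rewrite expr0 u1.
  exact: finite_measure_integrable_cst.
by have [] := mean_le0.
Qed.

                                                                             
                                                                   
(** The hypothesis bounds odd moments only from above, while [a] may be negative. An odd moment is
    controlled in absolute value by the two neighbouring even ones through [qform_odd_le]; the price
    is [3 * c] in place of [c], which leaves the leading term of [psi] unchanged. *)
Lemma abs_moments (a : R) k : (2 <= k)%N ->
  cond_le P G (fun w => a * qform u (X w ^+ k))
    (fun w => `|a| * (k`!%:R / 2 * (3 * c) ^+ (k - 2)) * v w).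
Proof.
move=> k2; have kE : k = (odd k + k./2.*2)%N by rewrite odd_double_half.
have h1 : (0 < k./2)%N by rewrite half_gt0.
set j := k./2 in kE h1; case: (odd k) kE => kE.
- have k_odd : k = j.*2.+1 by rewrite kE.
  rewrite k_odd.
  pose g w := `|a| * ((c * qform u (X w ^+ j.*2) + c^-1 * qform u (X w ^+ j.*2.+2)) / 2).
  have j2 : (2 <= j.*2)%N by rewrite -leq_double in h1.
  have gE : g = fun w => `|a| * c / 2 * qform u (X w ^+ j.*2) +
                 `|a| / c / 2 * qform u (X w ^+ j.*2.+2).
    by apply/funext => w; rewrite /g; ring.
  apply: (cond_le_trans (g := g)).
    apply: cond_leW => //.
    + exact: integrable_scale.
    + by rewrite gE; apply: integrable_add; exact: integrable_scale.
    + move=> w; apply: le_trans (ler_norm _) _; rewrite normrM ler_wpM2l//.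
      exact: qform_odd_le.
  rewrite gE.
  apply: cond_le_trans.
    have a0 : 0 <= `|a| * c / 2 by rewrite !mulr_ge0// ltW.
    have b0 : 0 <= `|a| / c / 2 by rewrite !mulr_ge0// invr_ge0 ltW.
    apply: cond_leD => //.
      exact: (cond_leZ Gm a0 (moments j2)).
    exact: (cond_leZ Gm b0 (moments (leq_trans j2 (leqW (leqnSn _))))).
  apply: cond_leW => //.
  + by apply: integrable_add; apply: integrable_scale; apply: integrable_scale.
  + exact: integrable_scale.
  + move=> w; rewrite !mulrA -mulrDl ler_wpM2r//.
    rewrite -!mulrA -mulrDr ler_wpM2l// exprMn.
    have [i ji] : exists i, j.*2 = i.+2 by exists (j.*2.-2); move: j2; case: (j.*2) => [|[]].
    have := fact_bernstein_le h1; rewrite ji.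
    rewrite !subSS !subn0 succnK.
    move: (i.+2)`! (i.+3)`! (i.+4)`! => f0 f1 f2.
    rewrite -(ler_nat R) !natrM natrD natrX exprS => le.
    have ci : 0 <= c * c ^+ i / 4.
      by rewrite divr_ge0// mulr_ge0 ?exprn_ge0 ?(ltW c_gt0).
    rewrite exprS; apply: le_trans (_ : c * c ^+ i / 4 * (f0%:R + f2%:R) <= _).
      by rewrite le_eqVlt; apply/orP; left; apply/eqP; rewrite exprS; field; rewrite gt_eqF.
    apply: le_trans (ler_wpM2l ci le) _.
    by rewrite le_eqVlt; apply/orP; left; apply/eqP; rewrite exprS; field.
- have k_even : k = j.*2 by rewrite kE.
  apply: (cond_le_trans (g := fun w => `|a| * qform u (X w ^+ k))).
    apply: cond_leW => //; try exact: integrable_scale.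
    by move=> w; rewrite ler_wpM2r ?ler_norm// k_even qform_even_ge0.
  apply: (cond_le_trans (cond_leZ Gm (normr_ge0 a) (moments k2))).
  apply: cond_leW => //.
  + by apply: integrable_scale; exact: integrable_scale.
  + exact: integrable_scale.
  + move=> w; rewrite mulrA ler_wpM2r// ler_wpM2l// ler_wpM2l//.
    rewrite lerXn2r ?nnegrE ?mulr_ge0 ?(ltW c_gt0)//.
    by rewrite ler_peMl ?(ltW c_gt0)// ler1n.
Qed.

Lemma qform_exp_expansion (Z : 'M[R]_n) (t : R) N :
  qform u ((t *: Z + 1) ^+ N) =
  \sum_(k < N.+1) ('C(N, k)%:R * t ^+ k) * qform u (Z ^+ k).
Proof.
have expZ k : (t *: Z) ^+ k = t ^+ k *: Z ^+ k.
  elim: k => [|k IH]; first by rewrite !expr0 scale1r.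
  rewrite exprS IH.
  transitivity ((t *: Z) *m (t ^+ k *: Z ^+ k)); first by [].
  by rewrite -scalemxAl -scalemxAr scalerA -exprS (exprS Z).
rewrite exprD1n qform_sum; apply: eq_bigr => k _.
rewrite expZ; elim: ('C(N, k)) => [|m IH].
  by rewrite mulr0n mul0r mul0r -(scale0r (1 : 'M[R]_n)) qformZ mul0r.
by rewrite mulrS qformD IH qformZ -natr1; ring.
Qed.

Lemma binom_coeff_le (l : R) N k : 0 <= l ->
  'C(N, k)%:R * (l / N%:R) ^+ k * k`!%:R <= l ^+ k.
Proof.
move=> l0; have le : (N ^_ k <= N ^ k)%N.
  elim: k => [|k IH]; first by [].
  by rewrite ffactnSr expnSr leq_mul// leq_subr.
rewrite mulrAC -natrM bin_ffact expr_div_n mulrCA ler_piMr ?exprn_ge0//.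
have [->|N0] := eqVneq N 0%N.
  case: k {le} => [|k]; first by rewrite expr0 invr1 mulr1.
  by rewrite expr0n/= invr0 mulr0.
by rewrite ler_pdivrMr ?exprn_gt0 ?ltr0n ?lt0n// mul1r -natrX ler_nat.
Qed.

(** The exponential is the limit of $(1+ly/N)^N$ with $y$ = [qform u (X w)]. Jensen's inequality
    moves the $N$-th power inside the quadratic form, leaving a polynomial in [X] to which finitely
    many moment bounds apply, uniformly in $N$. Fatou's lemma passes to the limit. *)
Lemma bernstein_expR (l : R) : `|l| * (3 * c) < 1 -> forall B, G B ->
  (\int[P]_(w in B) (expR (l * qform u (X w)))%:E <=
   \int[P]_(w in B) (1 + l ^+ 2 / 2 / (1 - `|l| * (3 * c)) * v w)%:E)%E.
Proof.
move=> lc B GB; have mB := Gm GB.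
set psi := l ^+ 2 / 2 / _.
(* The exponent [2 ^ m.+1] is always even, which makes [f] nonnegative as Fatou's lemma requires. *)
pose f m w := (1 + l * qform u (X w) / (2 ^ m.+1)%:R) ^+ (2 ^ m.+1).
have f_ge0 m w : 0 <= f m w by rewrite /f {2}expnS exprM exprn_ge0 ?sqr_ge0.
have q0 : 0 <= `|l| * (3 * c) by rewrite mulr_ge0// mulr_ge0// ltW.
have psi0 : 0 <= psi by rewrite /psi divr_ge0 ?subr_ge0 ?(ltW lc)// divr_ge0 ?sqr_ge0.
have bound_int : P.-integrable setT (EFin \o (fun w => 1 + psi * v w)).
  apply: integrable_add; last exact: integrable_scale.
  exact: (finite_measure_integrable_cst P 1).
have f_le m : cond_le P G (f m) (fun w => 1 + psi * v w).
  set N := (2 ^ m.+1)%N; pose t := l / N%:R.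
  have N2 : exists N', N = N'.+2.
    exists N.-2; have : (2 <= N)%N by rewrite /N expnS leq_pmulr// expn_gt0.
    by case: (N) => [|[]].
  pose coef k := 'C(N, k)%:R * t ^+ k.
  (* Termwise majorant of the binomial expansion: order 0 gives 1, order 1 vanishes by the
     martingale property, higher orders come from [abs_moments]. *)
  pose g k w := if k is k'.+2 then
    `|coef k| * (k`!%:R / 2 * (3 * c) ^+ (k - 2)) * v w else (k == 0%N)%:R.
  have fE w : f m w <= \sum_(k < N.+1) coef k * qform u (X w ^+ k).
    rewrite -qform_exp_expansion.
    have -> : f m w = qform u (t *: X w + 1) ^+ N.
      by rewrite qformD qformZ u1 /f addrC /t mulrAC.
    apply: qform_pow2_le => //.
    by rewrite linearD/= linearZ/= sX -[1%R]/(1%:M) tr_scalar_mx.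
  have sum_le : cond_le P G (fun w => \sum_(k < N.+1) coef k * qform u (X w ^+ k))
      (fun w => \sum_(k < N.+1) g k w).
    apply: (cond_le_sum Gm) => k.
    case: (nat_of_ord k) => [|[|k']]; last exact: abs_moments.
      rewrite (_ : (fun w => _) = cst 1).
        exact: cond_le_cst.
      by apply/funext => w; rewrite expr0 u1 /coef bin0 expr0 !mulr1.
    rewrite /g/=; under eq_fun do rewrite expr1.
    rewrite [X in cond_le _ _ _ X](_ : _ = (fun w : T => coef 1%N * 0)); last first.
      by apply/funext => w; rewrite mulr0.
    exact: (cond_leZ_eq Gm _ mean_le0 mean_ge0).
  have g_le w : \sum_(k < N.+1) g k w <= 1 + psi * v w.
    have [N' NE] := N2; rewrite NE big_ord_recl big_ord_recl/= add0r lerD2l.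
    rewrite -mulr_suml ler_wpM2r//.
    (* The binomial coefficient cancels the factorial of the moment bound, and a geometric series
       remains. *)
    apply: (@le_trans _ _ (\sum_(i < N'.+1) l ^+ 2 / 2 * (`|l| * (3 * c)) ^+ i)).
      apply: ler_sum => i _; rewrite /bump/= !add1n !subSS subn0.
      have := @binom_coeff_le `|l| N i.+2 (normr_ge0 l).
      have <- : `|coef i.+2| = 'C(N, i.+2)%:R * (`|l| / N%:R) ^+ i.+2.
        by rewrite /coef /t normrM normrX normf_div !normr_nat.
      move=> le.
      have : 0 <= 3 * c by rewrite mulr_ge0// ltW.
      move: (3 * c) => y y0.
      rewrite exprMn !mulrA ler_wpM2r ?exprn_ge0//.
      rewrite [leRHS]mulrAC ler_wpM2r ?invr_ge0//.
      by apply: le_trans le _; rewrite -(real_normK (num_real l)) -exprD.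
    rewrite -mulr_sumr ler_wpM2l ?divr_ge0 ?sqr_ge0//.
    rewrite -[leRHS]mul1r ler_pdivlMr ?subr_gt0// mulrC.
    by rewrite -opprB mulNr -subrX1 opprB gerBl exprn_ge0.
  have [sum_int g_int _] := sum_le.
  have f_int : P.-integrable setT (EFin \o f m).
    apply: (le_integrable measurableT _ _ sum_int) => [|w _ /=].
      apply/measurable_EFinP; apply: measurable_funX; apply: measurable_funD.
        exact: measurable_cst.
      apply: measurable_funM; last exact: measurable_cst.
      apply: measurable_funM; first exact: measurable_cst.
      by apply/measurable_EFinP; exact: measurable_int (moment_int 1).
    rewrite lee_fin ger0_norm//; apply: le_trans (fE w) (ler_norm _).
  apply: cond_le_trans (cond_leW Gm f_int sum_int fE) _.
  by apply: cond_le_trans sum_le _; exact: cond_leW.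
have cvg w : f ^~ w @ \oo --> expR (l * qform u (X w)).
  by have := @one_plus_pow_expR R (l * qform u (X w)); rewrite -cvg_shiftS.
have -> : (\int[P]_(w in B) (expR (l * qform u (X w)))%:E =
           \int[P]_(w in B) limn_einf (fun m => (f m w)%:E))%E.
  apply: eq_integral => w _.
  have cvg' : (f m w)%:E @[m --> \oo] --> (expR (l * qform u (X w)))%:E.
    by apply: cvg_EFin; [exact: nearW|exact: cvg].
  rewrite is_cvg_limn_einfE; first by rewrite (cvg_lim _ cvg').
  by apply/cvg_ex; eexists; exact: cvg'.
apply: le_trans.
  apply: fatou => // [m|m w _]; last by rewrite lee_fin.
  have [/measurable_int fi _ _] := f_le m.
  exact: measurable_funTS.
rewrite limn_einf_lim; apply: lime_le; first exact: is_cvg_einfs.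
apply: nearW => m; apply: le_trans (_ : \int[P]_(w in B) (f m w)%:E <= _)%E.
  by apply: ereal_inf_lbound; exists m => /=.
by have [_ _ ->] := f_le m.
Qed.

End bernstein.

                               

(** * A self-normalized exponential moment *)

Section self_normalized.
Context (d : measure_display) (T : measurableType d) (R : realType).
Variables (P : probability T R) (G : set (set T)).
Hypothesis Gm : G `<=` measurable.
Variables (x v : T -> R).
Hypotheses (mean_le0 : cond_le P G x (cst 0)) (mean_ge0 : cond_le P G (cst 0) x).
Hypothesis second_moment : cond_le P G (fun w => x w ^+ 2) v.

(** Subtracting a multiple of $x^2$ inside the exponential tames large values, in place of a bound
    on higher moments; [expR_le_quadratic] then reduces everything to the first two moments. *)
Lemma self_normalized_expR (l : R) B : G B ->
  (\int[P]_(w in B) (expR (l * x w - l ^+ 2 / 6 * x w ^+ 2))%:E <=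
   \int[P]_(w in B) (1 + l ^+ 2 / 3 * v w)%:E)%E.
Proof.
move=> GB; have mB := Gm GB.
have lin : cond_le P G (fun w => l * x w) (cst 0).
  rewrite [X in cond_le _ _ _ X](_ : _ = (fun w : T => l * 0)); last first.
    by apply/funext => w; rewrite mulr0.
  exact: (cond_leZ_eq Gm _ mean_le0 mean_ge0).
have l2 : 0 <= l ^+ 2 / 3 by rewrite divr_ge0 ?sqr_ge0.
pose q w := 1 + (l * x w + l ^+ 2 / 3 * x w ^+ 2).
have quad : cond_le P G q (fun w => 1 + l ^+ 2 / 3 * v w).
  have := cond_leD Gm (cond_le_cst P Gm 1)
    (cond_leD Gm lin (cond_leZ Gm l2 second_moment)).
  by under [X in cond_le _ _ _ X -> _]eq_fun do rewrite add0r.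
have [qi _ le] := quad.
apply: le_trans (le _ GB); have mx : measurable_fun setT x.
  by have [/measurable_int /measurable_EFinP] := mean_le0.
apply: ge0_le_integral => //.
- apply/measurable_EFinP; apply: measurable_funTS.
  apply: (measurableT_comp (@measurable_expR R)).
  apply: measurable_funB; (apply: measurable_funM; first exact: measurable_cst) => //.
  exact: measurable_funX.
- by apply: measurable_funTS; exact: measurable_int qi.
- move=> w _; rewrite lee_fin /q.
  have := expR_le_quadratic (l * x w).
  rewrite exprMn => le'; apply: le_trans (le_trans _ le') _.
    by rewrite le_eqVlt; apply/orP; left; apply/eqP; congr expR; ring.
  by rewrite le_eqVlt; apply/orP; left; apply/eqP; ring.
Qed.

End self_normalized.

(** * Comparison of a sum with its compensator by dyadic truncation *)

Section truncation_sums.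
Context {R : realType}.
Implicit Types z : R.

(** The companion bound [2 ^+ K] carries the induction: when the term [2 ^+ K] is present it is
    below [z], and so the sum doubles to less than [2 * z]. *)
Lemma sum_dyadic_tail z K : 0 <= z ->
  \sum_(k < K) 2 ^+ k * (2 ^+ k < z)%R%:R <= 2 * z.
Proof.
move=> z0; suff [//] : \sum_(k < K) 2 ^+ k * (2 ^+ k < z)%R%:R <= 2 * z /\
    \sum_(k < K) 2 ^+ k * (2 ^+ k < z)%R%:R <= 2 ^+ K :> R.
elim: K => [|K [IH1 IH2]]; first by rewrite big_ord0 expr0 mulr_ge0.
rewrite big_ord_recr/=; have p0 : 0 < 2 ^+ K :> R by rewrite exprn_gt0.
case: ltP => h; rewrite ?mulr1 ?mulr0 ?addr0 exprS; split; lra.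
Qed.

(** Once [2 ^+ K] has reached [z], the terms still to come form a geometric series of total
    $2z^2/2^K$; the invariant [inv1] includes this remainder. *)
Lemma sum_dyadic_truncated z K : 0 <= z ->
  \sum_(k < K) 2 ^- k * (z ^+ 2 * (z <= 2 ^+ k)%R%:R) <= 2 * z.
Proof.
move=> z0; set S := fun K => \sum_(k < K) 2 ^- k * (z ^+ 2 * (z <= 2 ^+ k)%R%:R).
suff [inv1 inv2] : (z <= 2 ^+ K -> S K + 2 * (z ^+ 2 / 2 ^+ K) <= 2 * z) /\
    (2 ^+ K < z -> S K = 0).
  rewrite -/(S K); have [/inv1|/inv2 ->] := leP z (2 ^+ K); last by rewrite mulr_ge0.
  by apply: le_trans; rewrite lerDl mulr_ge0// divr_ge0 ?sqr_ge0 ?exprn_ge0.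
elim: K => [|K [IH1 IH2]].
  rewrite /S big_ord0 expr0; split => // z1.
  by rewrite add0r divr1 ler_pM2l// expr2 ler_piMl.
have p0 : 0 < 2 ^+ K :> R by rewrite exprn_gt0.
have -> : S K.+1 = S K + z ^+ 2 / 2 ^+ K * (z <= 2 ^+ K)%R%:R.
  by rewrite /S big_ord_recr/=; congr (_ + _); rewrite mulrA [X in X * _]mulrC.
have E : 2 * (z ^+ 2 / 2 ^+ K.+1) = z ^+ 2 / 2 ^+ K.
  by rewrite [2 ^+ K.+1]exprS; field; rewrite gt_eqF.
rewrite E; have [h|h] := leP z (2 ^+ K); rewrite ?mulr1 ?mulr0 ?addr0.
  split=> [_|]; first by have := IH1 h; lra.
  by rewrite [2 ^+ K.+1]exprS; lra.
rewrite IH2//; split=> // zK; rewrite add0r ler_pdivrMr// expr2 -mulrA.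
by rewrite [leRHS]mulrCA ler_wpM2l// -exprS.
Qed.

End truncation_sums.

Section identically_distributed.
Context (d : measure_display) (T : measurableType d) (R : realType).
Variables (P : probability T R) (x y : T -> R).
Hypotheses (mx : measurable_fun setT x) (my : measurable_fun setT y).
Hypothesis xy : forall B : set R, measurable B -> P (x @^-1` B) = P (y @^-1` B).

Lemma ge0_integral_identically_distributed (h : R -> R) :
  measurable_fun setT h -> (forall r, 0 <= h r) ->
  (\int[P]_w (h (x w))%:E = \int[P]_w (h (y w))%:E)%E.
Proof.
move=> mh h0.
have mEh : measurable_fun setT (EFin \o h) by exact/measurable_EFinP.
have Eh0 : {in setT, forall r, (0 <= (EFin \o h) r)%E}.
  by move=> r _; rewrite lee_fin.
have := ge0_integral_pushforward mx P measurableT mEh Eh0.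
rewrite preimage_setT => <-.
have := ge0_integral_pushforward my P measurableT mEh Eh0.
rewrite preimage_setT => <-.
by apply: eq_measure_integral => B mB _; exact: xy.
Qed.

End identically_distributed.

Lemma ge0_sume_const (R : realType) (x : \bar R) n : (0 <= x)%E ->
  (\sum_(i < n) x = (n%:R)%:E * x)%E.
Proof.
move=> x0; elim: n => [|n IH]; first by rewrite big_ord0 mul0e.
by rewrite big_ord_recr/= IH -natr1 EFinD ge0_muleDl ?lee_fin// mul1e.
Qed.

Section dominated_sums.
Context (d : measure_display) (T : measurableType d) (R : realType).
Variables (P : probability T R) (F : nat -> set (set T)).
Hypothesis fF : filtration F.
Variables (z v : nat -> T -> R).
Hypotheses (mz : forall i, measurable_wrt (F i.+1) (z i))
  (mv : forall i, measurable_wrt (F i) (v i)).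
Hypotheses (z_ge0 : forall i w, 0 <= z i w) (v_ge0 : forall i w, 0 <= v i w).
Hypothesis zv : forall i, cond_le P (F i) (z i) (v i).
Hypothesis z_id : forall i (B : set R), measurable B ->
  P (z i @^-1` B) = P (z 0 @^-1` B).

Let sF t : sigma_algebra setT (F t). Proof. by case: fF. Qed.
Let Fm t : F t `<=` measurable. Proof. by case: fF. Qed.
Let FS s t : (s <= t)%N -> F s `<=` F t. Proof. by case: fF => _ _; apply. Qed.

Let mz' i : measurable_fun setT (z i).
Proof. exact: measurable_wrt_fun (@Fm i.+1) (mz i). Qed.

Let mpos (a : R) : measurable_fun setT (fun x : R => Num.max (x - a) 0).
Proof.
apply: measurable_maxr; last exact: measurable_cst.
by apply: measurable_funB => //; exact: measurable_cst.
Qed.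

Let trunc (k : nat) (r : R) := r * (r <= 2 ^+ k)%R%:R.

Let trunc_ge0 k r : 0 <= r -> 0 <= trunc k r.
Proof. by move=> r0; rewrite mulr_ge0. Qed.

Let trunc_le k r : 0 <= r -> trunc k r <= r.
Proof. by move=> r0; rewrite ler_piMr// lern1 leq_b1. Qed.

Let mtrunc k : measurable_fun setT (trunc k).
Proof.
rewrite (_ : trunc k = (fun r => r * \1_(`]-oo, 2 ^+ k]) r)).
  by apply: measurable_funM => //; exact: measurable_indic.
by apply/funext => r; rewrite /trunc indicE mem_setE in_itv.
Qed.

(** Only [z] is truncated, not its compensator, so [S] has nonpositive conditional drift. The
    squared positive part [L] records upward deviations alone. *)
Let S k n w := \sum_(i < n) (trunc k (z i w) - v i w).
Let L k n w := Num.max (S k n w) 0 ^+ 2.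

Let mS k n : measurable_wrt (F n) (S k n).
Proof.
elim: n => [|n IH].
  rewrite (_ : S k 0 = cst 0); first exact: measurable_wrt_cst.
  by apply/funext => w; rewrite /S big_ord0.
rewrite (_ : S k n.+1 = (fun w => S k n w + (trunc k (z n w) - v n w))).
  apply: measurable_wrtD => //; first exact: measurable_wrtS (FS (leqnSn n)) IH.
  apply: measurable_wrtB => //.
    exact: measurable_wrt_comp (mtrunc k) (mz n).
  exact: measurable_wrtS (FS (leqnSn n)) (mv n).
by apply/funext => w; rewrite /S big_ord_recr.
Qed.

Let mposX (a : R) : measurable_fun setT (fun x : R => Num.max (x - a) 0 ^+ 2).
Proof. by apply: measurable_funX; exact: mpos. Qed.

Let mL k n : measurable_wrt (F n) (L k n).
Proof.
rewrite (_ : L k n = (fun w => Num.max (S k n w - 0) 0 ^+ 2)).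
  exact: (measurable_wrt_comp (sF n) (mposX 0) (mS k n)).
by apply/funext => w; rewrite subr0.
Qed.

(** With $a=(S-v)^+$ and $t$ the truncated term, the next value of [L] is at most $(a+t)^2\le
    a^2+2az+t^2$. Conditioning replaces $z$ by $v$, and $a^2+2av\le(S^+)^2$. *)
Let L_step k n B : F n B ->
  (\int[P]_(w in B) (L k n.+1 w)%:E <=
   \int[P]_(w in B) (L k n w)%:E + \int[P]_(w in B) (trunc k (z n w) ^+ 2)%:E)%E.
Proof.
move=> FB; have mB := Fm FB.
pose a w := Num.max (S k n w - v n w) 0.
have a0 w : 0 <= a w by rewrite le_max lexx orbT.
have ma : measurable_wrt (F n) a.
  rewrite (_ : a = (fun w => Num.max ((S k n w - v n w) - 0) 0)).
    apply: (measurable_wrt_comp (sF n) (mpos 0)).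
    by apply: measurable_wrtB.
  by apply/funext => w; rewrite subr0.
have ma' := measurable_wrt_fun (@Fm n) ma.
have m2a : measurable_wrt (F n) (fun w => 2 * a w).
  by apply: measurable_wrtM => //; exact: measurable_wrt_cst.
have mvn := measurable_wrt_fun (@Fm n) (mv n).
have mt : measurable_fun setT (fun w => trunc k (z n w)).
  exact: measurableT_comp (mtrunc k) (mz' n).
have [_ _ le_zv] := zv n.
have le2 := weighted_integral_le (sF n) (@Fm n) (mz' n) mvn (z_ge0 n) (v_ge0 n)
  le_zv m2a (fun w => mulr_ge0 (ler0n _ 2) (a0 w)) FB.
have mfun (f : T -> R) : measurable_fun setT f -> measurable_fun B (fun w => (f w)%:E).
  by move=> mf; apply/measurable_EFinP; exact: measurable_funTS.
have m2az : measurable_fun setT (fun w => 2 * a w * z n w).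
  by apply: measurable_funM => //; exact: measurable_wrt_fun (@Fm n) m2a.
have m2av : measurable_fun setT (fun w => 2 * a w * v n w).
  by apply: measurable_funM => //; exact: measurable_wrt_fun (@Fm n) m2a.
have ma2 : measurable_fun setT (fun w => a w ^+ 2) by exact: measurable_funX.
have mt2 : measurable_fun setT (fun w => trunc k (z n w) ^+ 2) by exact: measurable_funX.
apply: (@le_trans _ _ (\int[P]_(w in B)
    ((a w ^+ 2)%:E + (2 * a w * z n w)%:E + (trunc k (z n w) ^+ 2)%:E))%E).
  apply: ge0_le_integral => //.
  - by move=> w _; rewrite lee_fin sqr_ge0.
  - by apply: mfun; exact: measurable_wrt_fun (@Fm n.+1) (mL k n.+1).
  - by apply: emeasurable_funD; [apply: emeasurable_funD|]; exact: mfun.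
  - move=> w _; rewrite -!EFinD lee_fin /L.
    have -> : S k n.+1 w = S k n w + (trunc k (z n w) - v n w).
      by rewrite /S big_ord_recr.
    have t0 := trunc_ge0 k (z_ge0 n w); have tz := trunc_le k (z_ge0 n w).
    apply: (@le_trans _ _ ((a w + trunc k (z n w)) ^+ 2)).
      rewrite lerXn2r ?nnegrE ?addr_ge0 ?le_max ?lexx ?orbT//.
      rewrite ge_max addr_ge0// andbT addrCA addrC lerD2r.
      by rewrite /a le_max lexx.
    have := a0 w; nra.
rewrite ge0_integralD//; last 4 first.
- by move=> w _; rewrite -EFinD lee_fin addr_ge0 ?sqr_ge0// !mulr_ge0.
- by apply: emeasurable_funD; exact: mfun.
- by move=> w _; rewrite lee_fin sqr_ge0.
- exact: mfun.
apply: leeD2r.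
rewrite ge0_integralD//; last 4 first.
- by move=> w _; rewrite lee_fin sqr_ge0.
- exact: mfun.
- by move=> w _; rewrite lee_fin !mulr_ge0.
- exact: mfun.
apply: le_trans (leeD2l _ le2) _.
rewrite -ge0_integralD//; last 4 first.
- by move=> w _; rewrite lee_fin sqr_ge0.
- exact: mfun.
- by move=> w _; rewrite lee_fin !mulr_ge0.
- exact: mfun.
apply: ge0_le_integral => //.
- by move=> w _; rewrite -EFinD lee_fin addr_ge0 ?sqr_ge0// !mulr_ge0.
- by apply: emeasurable_funD; exact: mfun.
- by apply: mfun; exact: measurable_wrt_fun (@Fm n) (mL k n).
- move=> w _; rewrite -EFinD lee_fin /L /a.
  have := v_ge0 n w; set s := S k n w; set y := v n w => y0.
  case: (leP (s - y) 0) => sy; first by rewrite expr0n/= add0r mulr0 mul0r sqr_ge0.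
  rewrite (max_l _); first by nra.
  by lra.
Qed.

Let f (k : nat) (r : R) : R := 2 ^+ k * (2 ^+ k < r)%R%:R.
Let g (k : nat) (r : R) : R := 2 ^- k * (r ^+ 2 * (r <= 2 ^+ k)%R%:R).

Let f_ge0 k r : 0 <= f k r. Proof. by rewrite /f mulr_ge0 ?exprn_ge0. Qed.
Let g_ge0 k r : 0 <= g k r.
Proof. by rewrite /g mulr_ge0 ?invr_ge0 ?exprn_ge0// mulr_ge0 ?sqr_ge0. Qed.

Let mf k : measurable_fun setT (f k).
Proof.
rewrite (_ : f k = (fun r => 2 ^+ k * \1_(`]2 ^+ k, +oo[) r)).
  by apply: measurable_funM; [exact: measurable_cst|exact: measurable_indic].
by apply/funext => r; rewrite /f indicE mem_setE in_itv/= andbT.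
Qed.

Let truncX k r : trunc k r ^+ 2 = 2 ^+ k * g k r.
Proof.
have p0 : 2 ^+ k != 0 :> R by rewrite expf_neq0.
rewrite /g mulrA divff// mul1r /trunc exprMn.
by case: (_ <= _); rewrite ?expr1n ?expr0n.
Qed.

Let mg k : measurable_fun setT (g k).
Proof.
rewrite (_ : g k = (fun r => 2 ^- k * (trunc k r ^+ 2))).
  by apply: measurable_funM; [exact: measurable_cst|exact: measurable_funX].
apply/funext => r; rewrite truncX mulrA mulVf ?mul1r//.
Qed.

Let int_id (h : R -> R) i : measurable_fun setT h -> (forall r, 0 <= h r) ->
  (\int[P]_w (h (z i w))%:E = \int[P]_w (h (z 0 w))%:E)%E.
Proof.
by move=> mh h0; apply: ge0_integral_identically_distributed => //; exact: z_id.
Qed.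

Let large k := \big[setU/set0]_(i < 2 ^ k) [set w | 2 ^+ k < z i w].

Let m_level k i : measurable [set w | 2 ^+ k < z i w].
Proof.
rewrite (_ : [set w | _] = z i @^-1` `]2 ^+ k, +oo[%classic).
  by rewrite -[X in measurable X]setTI; exact: mz'.
by apply/seteqP; split=> w /=; rewrite in_itv/= andbT.
Qed.

Let m_large k : measurable (large k).
Proof. exact: bigsetU_measurable. Qed.

Let P_large k : (P (large k) <= \int[P]_w (f k (z 0 w))%:E)%E.
Proof.
apply: (@le_trans _ _ (\sum_(i < 2 ^ k) P [set w | (2 ^+ k < z i w)%R])%E).
  apply: (@Boole_inequality _ _ _ P (fun i => [set w | 2 ^+ k < z i w])) => i _.
  exact: m_level.
have Pi i : P [set w | 2 ^+ k < z i w] = P [set w | 2 ^+ k < z 0 w].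
  have E j : [set w | 2 ^+ k < z j w] = z j @^-1` `]2 ^+ k, +oo[%classic.
    by apply/seteqP; split=> w /=; rewrite in_itv/= andbT.
  by rewrite !E z_id.
under eq_bigr do rewrite Pi.
rewrite ge0_sume_const//.
have -> : (\int[P]_w (f k (z 0 w))%:E =
    \int[P]_w ((2 ^+ k)%:E * (\1_[set w | (2 ^+ k < z 0 w)%R] w)%:E))%E.
  apply: eq_integral => w _; rewrite -EFinM /f indicE; congr (_ * _)%:E.
  by congr (_%:R); congr nat_of_bool; apply/idP/idP; rewrite inE.
rewrite ge0_integralZl//; last first.
  by apply/measurable_EFinP; exact: measurable_indic.
by rewrite integral_indic// setIT natrX.
Qed.

Let dev (eps : R) k := crossed (L k) ((eps / 2 * 2 ^+ k) ^+ 2) (2 ^ k).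

(** [ville] with the truncated squares as drift: there are $2^k$ steps of equal expectation, because
    the [z i] have the same law. *)
Let P_dev (eps : R) k : 0 < eps ->
  measurable (dev eps k) /\
  (P (dev eps k) <= (4 / eps ^+ 2)%:E * \int[P]_w (g k (z 0 w))%:E)%E.
Proof.
move=> e0; have mt i : measurable_fun setT (fun w => trunc k (z i w) ^+ 2).
  by apply: measurable_funX; exact: (measurableT_comp (mtrunc k) (mz' i)).
split; first exact: (measurable_crossed fF (mL k)).
have := ville fF (mL k) mt (fun t w => sqr_ge0 _) (fun t w => sqr_ge0 _)
  (@L_step k) (2 ^ k) (sqr_ge0 (eps / 2 * 2 ^+ k)).
rewrite integral0_eq ?add0e => [|w _]; last first.
  by rewrite /L /S big_ord0 maxxx expr0n.
have -> : (\sum_(t < 2 ^ k) \int[P]_w (trunc k (z t w) ^+ 2)%:E =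
    ((2 ^+ k) ^+ 2)%:E * \int[P]_w (g k (z 0 w))%:E)%E.
  have term i : (\int[P]_w (trunc k (z i w) ^+ 2)%:E =
      (2 ^+ k)%:E * \int[P]_w (g k (z 0 w))%:E)%E.
    under eq_integral do rewrite truncX EFinM.
    rewrite ge0_integralZl//; last first.
    - by move=> w _; rewrite lee_fin.
    - by apply/measurable_EFinP; exact: (measurableT_comp (mg k) (mz' i)).
    by rewrite int_id.
  under eq_bigr do rewrite term.
  rewrite ge0_sume_const; first by rewrite muleA -EFinM natrX expr2.
  apply: mule_ge0; first by rewrite lee_fin exprn_ge0.
  by apply: integral_ge0 => w _; rewrite lee_fin.
have a0 : 0 < (eps / 2 * 2 ^+ k) ^+ 2.
  by rewrite exprn_gt0// mulr_gt0 ?exprn_gt0// divr_gt0.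
rewrite -lee_pdivlMl// => /le_trans; apply.
rewrite muleA -EFinM le_eqVlt; apply/orP; left; apply/eqP; congr (_%:E * _)%E.
by field; rewrite !gt_eqF.
Qed.

                                                                                
                                                                 
(** Over the horizon $2^k$ with truncation at $2^k$ there are two bad events: a term exceeds the
    truncation level, or the truncated sum deviates upwards. By the dyadic sums both have
    probabilities summable in $k$, with total a multiple of the mean of [z 0], so Borel-Cantelli
    applies. *)
Lemma dominated_sum_le (eps : R) : 0 < eps ->
  {ae P, forall w, exists N, forall n, (N <= n)%N ->
    \sum_(i < n) z i w <= \sum_(i < n) v i w + eps * n%:R}.
Proof.
move=> e0; have [zint _ _] := zv 0.
pose C := 2 * fine (\int[P]_w (z 0 w)%:E).
have zC : (\int[P]_w (2 * z 0 w)%:E = C%:E)%E.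
  under eq_integral do rewrite EFinM.
  rewrite integralZl// EFinM fineK//.
  exact: integrable_fin_num zint.
have sum_le (h : nat -> R -> R) : (forall k, measurable_fun setT (h k)) ->
    (forall k r, 0 <= h k r) ->
    (forall r K, 0 <= r -> \sum_(k < K) h k r <= 2 * r) ->
    forall K, (\sum_(k < K) \int[P]_w (h k (z 0 w))%:E <= C%:E)%E.
  move=> mh h0 hle K; have mhz k : measurable_fun setT (fun w => (h k (z 0 w))%:E).
    by apply/measurable_EFinP; exact: (measurableT_comp (mh k) (mz' 0)).
  rewrite -ge0_integral_sum//; last by move=> k w _; rewrite lee_fin.
  rewrite -zC; apply: ge0_le_integral => //.
  - by move=> w _; rewrite sumEFin lee_fin sumr_ge0.
  - exact: emeasurable_sum.
  - apply/measurable_EFinP; apply: measurable_funM => //.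
  - by move=> w _; rewrite sumEFin lee_fin hle.
have mE k : measurable (large k `|` dev eps k).
  by apply: measurableU => //; have [] := P_dev k e0.
have e4 : 0 <= 4 / eps ^+ 2 by rewrite divr_ge0 ?sqr_ge0.
have : {ae P, forall w, exists K, forall k, (K <= k)%N ->
    ~ (large k `|` dev eps k) w}.
  apply: (ae_eventually_not (C := C + 4 / eps ^+ 2 * C)) => // K.
  apply: (@le_trans _ _ (\sum_(k < K) (\int[P]_w (f k (z 0 w))%:E +
    (4 / eps ^+ 2)%:E * \int[P]_w (g k (z 0 w))%:E))%E).
    apply: lee_sum => k _; have [mdev _] := P_dev k e0.
    apply: (@le_trans _ _ (P (large k) + P (dev eps k))%E).
      exact: measureU2.
    by apply: leeD; [exact: P_large|have [] := P_dev k e0].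
  rewrite big_split/= -ge0_sume_distrr; last first.
    by move=> k _; apply: integral_ge0 => w _; rewrite lee_fin.
  rewrite EFinD (EFinM _ C); apply: leeD.
    by apply: sum_le => // r K' r0; exact: sum_dyadic_tail.
  apply: lee_wpmul2l; first by rewrite lee_fin.
  by apply: sum_le => // r K' r0; exact: sum_dyadic_truncated.
apply: filterS => w [K nE]; exists (2 ^ K)%N => n Kn.
have n0 : (0 < n)%N by apply: leq_trans Kn; rewrite expn_gt0.
(* Then $2^{k-1}\le n<2^k$: all indices below [n] belong to block [k], and the threshold
   [eps / 2 * 2 ^+ k] is at most [eps * n%:R]. *)
pose k := (trunc_log 2 n).+1.
have /andP[n1 n2] := trunc_log_bounds (isT : 1 < 2)%N n0.
have Kk : (K <= k)%N.
  rewrite -ltnS -(ltn_exp2l _ _ (isT : 1 < 2)%N).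
  by apply: leq_ltn_trans Kn _; apply: leq_trans n2 _; rewrite leq_exp2l.
have [nl nd] : ~ large k w /\ ~ dev eps k w.
  by split=> h; apply: (nE k Kk); [left|right].
have zk (i : 'I_n) : z i w = trunc k (z i w).
  rewrite /trunc leNgt; case: ltP => //= h; last by rewrite mulr1.
  exfalso; apply: nl; rewrite /large -(bigcup_mkord _ (fun i => [set w | 2 ^+ k < z i w])).
  by exists (nat_of_ord i) => //=; exact: ltn_trans (ltn_ord i) n2.
rewrite -lerBlDl -sumrB.
have -> : \sum_(i < n) (z i w - v i w) = S k n w.
  by apply: eq_bigr => i _; rewrite {1}zk.
rewrite leNgt; apply/negP => hS; apply: nd; exists n; first exact: ltnW.
have h2 : 2 ^+ k <= 2 * n%:R :> R.
  by rewrite exprS ler_pM2l// -natrX ler_nat.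
have hS' : eps / 2 * 2 ^+ k <= S k n w.
  apply: le_trans (ltW hS); rewrite -mulrA ler_pM2l//.
  by rewrite ler_pdivrMl.
rewrite /L lerXn2r ?nnegrE ?le_max ?lexx ?orbT//.
- by rewrite mulr_ge0 ?exprn_ge0// divr_ge0// ltW.
- by rewrite hS'.
Qed.

End dominated_sums.

(** * Linear frequency of independent events *)

Section frequent_visits.
Context (d : measure_display) (T : measurableType d) (R : realType).
Variables (P : probability T R) (D : nat -> set T) (p : R).
Hypotheses (mD : forall i, measurable (D i)) (p_gt0 : 0 < p).
Hypothesis indep : forall s : seq nat, uniq s ->
  P (\bigcap_(i in [set` s]) D i) = (p ^+ size s)%:E.

(** Chosen so that $1-r1_D=e^{-1_D}$, which makes the product [W] the exponential of minus the
    number of visits. *)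
Let r : R := 1 - expR (- 1).

Let r_gt0 : 0 < r.
Proof. by rewrite subr_gt0 expR_lt1 oppr_lt0. Qed.

Let r_lt1 : r < 1.
Proof. by rewrite /r ltrBlDr ltrDl expR_gt0. Qed.

Let W (s : seq nat) w := \prod_(i <- s) (1 - r * \1_(D i) w).

Let W_ge0 s w : 0 <= W s w.
Proof.
apply: prodr_ge0 => i _; rewrite indicE subr_ge0.
by case: (_ \in _); rewrite ?mulr1 ?mulr0// ltW.
Qed.

Let mW s : measurable_fun setT (W s).
Proof.
elim: s => [|i s IH].
  rewrite (_ : W [::] = cst 1); first exact: measurable_cst.
  by apply/funext => w; rewrite /W big_nil.
rewrite (_ : W (i :: s) = (fun w => (1 - r * \1_(D i) w) * W s w)).
  apply: measurable_funM => //; apply: measurable_funB.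
    exact: measurable_cst.
  apply: measurable_funM; first exact: measurable_cst.
  exact: measurable_indic.
by apply/funext => w; rewrite /W big_cons.
Qed.

Let mcap (s : seq nat) : measurable (\bigcap_(i in [set` s]) D i).
Proof. by apply: bigcap_measurableType => // i _. Qed.

(** Independence is given for intersections of the [D i] themselves. Expanding one weight as
    $1-r1_D$ moves its index from the weighted list to the intersection, hence the induction over
    two lists. *)
Let expectation_weights s1 s2 : uniq (s1 ++ s2) ->
  (\int[P]_(w in \bigcap_(i in [set` s1]) D i) (W s2 w)%:E =
   (p ^+ size s1 * (1 - r * p) ^+ size s2)%:E)%E.
Proof.
elim: s2 s1 => [|x s2 IH] s1 us.
  rewrite (eq_integral (cst 1%E)); last by move=> w _; rewrite /W big_nil.
  rewrite integral_cst ?mul1e ?expr0 ?mulr1; last exact: mcap.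
  by apply: indep; move: us; rewrite cats0.
have us1 : uniq (s1 ++ s2).
  move: us; rewrite !cat_uniq /= negb_or => /and3P[-> /andP[_ ->] /andP[_ ->]].
  by [].
have us2 : uniq ((x :: s1) ++ s2) by rewrite -(uniq_catCA s1 [:: x]).
have IH1 := IH _ us1; have IH2 := IH _ us2.
set B := \bigcap_(i in _) _ in IH1 *.
have mB : measurable B := mcap s1.
have capE : \bigcap_(i in [set` x :: s1]) D i = B `&` D x.
  apply/seteqP; split=> w /=.
    by move=> h; split; [move=> i /= si; apply: h => /=; rewrite inE si orbT|
      apply: h => /=; rewrite mem_head].
  move=> [h1 h2] i /=; rewrite inE => /orP[/eqP -> //|]; exact: h1.
have mEW s (C : set T) : measurable_fun C (fun w => (W s w)%:E).
  by apply/measurable_EFinP; exact: measurable_funTS.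
have E : (\int[P]_(w in B) (W s2 w)%:E =
    \int[P]_(w in B) (W (x :: s2) w)%:E +
    r%:E * \int[P]_(w in B `&` D x) (W s2 w)%:E)%E.
  rewrite integral_mkcondr.
  have -> : (\int[P]_(w in B) ((fun w => (W s2 w)%:E) \_ (D x)) w =
      \int[P]_(w in B) (\1_(D x) w * W s2 w)%:E)%E.
    apply: eq_integral => w _; rewrite patchE indicE.
    by case: ifP; rewrite ?mul1r ?mul0r.
  have mI : measurable_fun B (fun w => (\1_(D x) w * W s2 w)%:E).
    apply/measurable_EFinP; apply: measurable_funTS.
    by apply: measurable_funM => //; exact: measurable_indic.
  rewrite -ge0_integralZl//; last 2 first.
  - by move=> w _; rewrite lee_fin mulr_ge0.
  - by rewrite lee_fin ltW.
  rewrite -ge0_integralD//; last 3 first.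
  - by move=> w _; rewrite lee_fin.
  - by move=> w _; rewrite -EFinM lee_fin !mulr_ge0// ltW.
  - exact: measurable_funeM.
  apply: eq_integral => w _; rewrite -EFinM -EFinD; congr EFin.
  by rewrite /W big_cons -/(W s2 w); ring.
move: E; rewrite IH1 -capE IH2 /= -EFinM.
move: (\int[P]_(w in B) _)%E => [y||] //= /eqP; rewrite -EFinD eqe => /eqP E.
by congr EFin; rewrite !exprS in E *; lra.
Qed.

                                                    
                                                   
(** Chernoff's bound: with [N] the number of visits, the mean of $e^{-N}$ is $(1-rp)^n\le
    e^{-2\delta n}$, so fewer than $\delta n$ visits occur with probability at most $e^{-\delta n}$,
    which is summable. *)
Lemma frequent_visits : exists2 delta : R, 0 < delta &
  {ae P, forall w, exists N, forall n, (N <= n)%N ->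
    delta * n%:R <= \sum_(i < n) \1_(D i) w}.
Proof.
pose delta := r * p / 2; have rp0 : 0 < r * p by rewrite mulr_gt0.
have d0 : 0 < delta by rewrite divr_gt0.
exists delta => //.
pose N n w := \sum_(i < n) \1_(D i) w : R.
have WN n w : W (iota 0 n) w = expR (- N n w).
  have -> : iota 0 n = index_iota 0 n by rewrite /index_iota subn0.
  rewrite /W big_mkord /N -sumrN expR_sum.
  apply: eq_bigr => i _; rewrite indicE; case: (_ \in _).
    by rewrite mulr1 /r; ring.
  by rewrite mulr0 subr0 oppr0 expR0.
have mN n : measurable_fun setT (N n).
  by apply: measurable_sum => i; exact: measurable_indic.
pose E n := [set w | N n w < delta * n%:R].
have mE n : measurable (E n).
  rewrite (_ : E n = N n @^-1` `]-oo, delta * n%:R[%classic).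
    by rewrite -[X in measurable X]setTI; exact: mN.
  by apply/seteqP; split=> w /=; rewrite in_itv.
have PE n : (P (E n) <= ((expR (- delta)) ^+ n)%:E)%E.
  have intW : (\int[P]_w (W (iota 0 n) w)%:E = ((1 - r * p) ^+ n)%:E)%E.
    have := @expectation_weights [::] (iota 0 n) (iota_uniq 0 n).
    rewrite (_ : \bigcap_(i in _) _ = setT) => [->|]; last first.
      by apply/seteqP; split=> w.
    by rewrite mul1r size_iota.
  have le : ((expR (- (delta * n%:R)))%:E * P (E n) <= ((1 - r * p) ^+ n)%:E)%E.
    rewrite -intW -integral_cst//.
    apply: (@le_trans _ _ (\int[P]_(w in E n) (W (iota 0 n) w)%:E)%E).
      apply: ge0_le_integral => //.
      - by move=> w _; rewrite lee_fin expR_ge0.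
      - by apply/measurable_EFinP; exact: measurable_funTS.
      - by move=> w Ew; rewrite lee_fin WN ler_expR lerN2 ltW.
    apply: ge0_subset_integral => //.
      exact/measurable_EFinP.
    by move=> w _; rewrite lee_fin.
  move: le; rewrite -lee_pdivlMl ?expR_gt0// => /le_trans; apply.
  rewrite -EFinM lee_fin -expRN opprK mulrC -expRM_natl mulrN.
  have rp1 : 1 - r * p <= expR (- (r * p)) by exact: expR_ge1Dx.
  (* Read off as the expectation of a single nonnegative weight. *)
  have q0 : 0 <= 1 - r * p.
    have := @expectation_weights [::] [:: 0%N] isT.
    rewrite (_ : \bigcap_(i in _) _ = setT); last by apply/seteqP; split=> w.
    rewrite mul1r expr1 => H.
    by rewrite -lee_fin -H; apply: integral_ge0 => w _; rewrite lee_fin.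
  apply: (@le_trans _ _ (expR (- (r * p)) ^+ n * expR (delta * n%:R))).
    by rewrite ler_wpM2r ?expR_ge0// lerXn2r ?nnegrE ?expR_ge0.
  rewrite -expRM_natl -expRD ler_expR le_eqVlt; apply/orP; left; apply/eqP.
  by rewrite /delta; field.
have q1 : expR (- delta) < 1 by rewrite expR_lt1 oppr_lt0.
have : {ae P, forall w, exists K, forall n, (K <= n)%N -> ~ E n w}.
  apply: (ae_eventually_not (C := (1 - expR (- delta))^-1)) => // K.
  apply: le_trans (_ : (\sum_(k < K) ((expR (- delta)) ^+ k)%:E <= _)%E).
    exact: lee_sum.
  rewrite sumEFin lee_fin -[leRHS]mul1r ler_pdivlMr ?subr_gt0// mulrC.
  by rewrite -opprB mulNr -subrX1 opprB gerBl exprn_ge0 ?expR_ge0.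
apply: filterS => w [K nE]; exists K => n Kn.
by rewrite leNgt; apply/negP; exact: nE.
Qed.

End frequent_visits.

(** * Multiplicative comparison for i.i.d. terms *)

Section iid_dominated_sums.
Context (d : measure_display) (T : measurableType d) (R : realType).
Variables (P : probability T R) (F : nat -> set (set T)).
Hypothesis fF : filtration F.
Variables (z v : nat -> T -> R).
Hypotheses (mz : forall i, measurable_wrt (F i.+1) (z i))
  (mv : forall i, measurable_wrt (F i) (v i)).
Hypotheses (z_ge0 : forall i w, 0 <= z i w) (v_ge0 : forall i w, 0 <= v i w).
Hypothesis zv : forall i, cond_le P (F i) (z i) (v i).
Hypothesis z_id : forall i (B : set R), measurable B ->
  P (z i @^-1` B) = P (z 0 @^-1` B).
Hypothesis z_indep : forall (s : seq nat) (B : set R), uniq s -> measurable B ->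
  P (\bigcap_(i in [set` s]) (z i @^-1` B)) =
  (\prod_(i <- s) P (z i @^-1` B))%E.

(** The additive error of [dominated_sum_le] is linear in [n]. It is absorbed because the sum of the
    [z i] itself grows at least linearly, unless the terms vanish almost surely. *)
Lemma iid_dominated_sum_le (eps : R) : 0 < eps ->
  {ae P, forall w, exists N, forall n, (N <= n)%N ->
    \sum_(i < n) z i w <= (1 + eps) * \sum_(i < n) v i w}.
Proof.
move=> e0; have [_ Fm _] := fF.
have mz' i : measurable_fun setT (z i) by exact: measurable_wrt_fun (@Fm i.+1) (mz i).
pose up m := `[m.+1%:R^-1, +oo[%classic : set R.
have mup m : measurable (up m) by exact: measurable_itv.
have mD m i : measurable (z i @^-1` up m).
  by rewrite -[X in measurable X]setTI; exact: mz'.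
(* Either some positive level is reached with positive probability, or all terms are almost surely
   zero and the bound is trivial. *)
have [[m Pm]|allzero] := pselect (exists m, P (z 0 @^-1` up m) != 0%E); last first.
  have : {ae P, forall w, forall i m, ~ up m (z i w)}.
    apply: ae_foralln => i; apply: ae_foralln => m.
    exists (z i @^-1` up m); split => //.
      rewrite [LHS]z_id//; apply/eqP/negPn/negP => h.
      by apply: allzero; exists m.
    by move=> w /= /contrapT.
  apply: filterS => w nz; exists 0%N => n _.
  rewrite big1 => [|i _]; first by rewrite mulr_ge0 ?sumr_ge0// addr_ge0// ltW.
  apply/eqP; rewrite eq_le z_ge0 andbT leNgt; apply/negP => zi0.
  have [m Hm] := ltr_add_invr zi0.
  apply: (nz i m); rewrite /up/= in_itv/= andbT.
  by rewrite add0r in Hm; exact: ltW.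
pose p := fine (P (z 0 @^-1` up m)).
have pE i : P (z i @^-1` up m) = p%:E.
  by rewrite z_id// /p fineK// fin_num_measure.
have p0 : 0 < p.
  by rewrite lt_neqAle -eqe -lee_fin -(pE 0%N) measure_ge0 andbT eq_sym.
have ind s : uniq s -> P (\bigcap_(i in [set` s]) (z i @^-1` up m)) = (p ^+ size s)%:E.
  move=> us; rewrite z_indep//; under eq_bigr do rewrite pE.
  by elim: s {us} => [|x s IH]; rewrite ?big_nil// big_cons IH /= exprS EFinM.
have [delta d0 visits] := frequent_visits (mD m) p0 ind.
pose kap := delta / m.+1%:R.
have k0 : 0 < kap by rewrite divr_gt0.
(* With this choice the error is at most $\frac{\varepsilon}{1+\varepsilon}Z$, and $Z\le
   V+\frac{\varepsilon}{1+\varepsilon}Z$ rearranges to $Z\le(1+\varepsilon)V$. *)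
pose eta := eps / (1 + eps) * kap.
have eta0 : 0 < eta by rewrite mulr_gt0// divr_gt0// addr_gt0.
have := dominated_sum_le fF mz mv z_ge0 v_ge0 zv z_id eta0.
apply: filterS2 visits => w [N1 v1] [N2 v2]; exists (maxn N1 N2) => n.
rewrite geq_max => /andP[/v1 h1 /v2 h2].
set Z := \sum_(i < n) z i w in h2 *; set V := \sum_(i < n) v i w in h2 *.
have h3 : kap * n%:R <= Z.
  rewrite /kap mulrAC ler_pdivrMr//; apply: le_trans h1 _.
  rewrite mulr_suml; apply: ler_sum => i _; rewrite indicE.
  case: (boolP (w \in _)) => [|_]; last by rewrite mulr_ge0.
  rewrite inE /up/= in_itv/= andbT => h.
  by rewrite -ler_pdivrMr// div1r.
have e1 : 0 < 1 + eps by rewrite addr_gt0.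
have : Z <= V + eps / (1 + eps) * Z.
  apply: le_trans h2 _; rewrite lerD2l /eta -mulrA ler_wpM2l//.
  by rewrite divr_ge0// ltW.
rewrite -(ler_pM2l e1) mulrDr mulrA mulrCA divff ?gt_eqF// mulr1; lra.
Qed.

End iid_dominated_sums.

                               

(** * Rayleigh quotients and the largest eigenvalue *)

Lemma continuous_bigsum (T : topologicalType) (R : realType) (I : Type)
    (s : seq I) (f : I -> T -> R) :
  (forall i, continuous (f i)) -> continuous (fun x => \sum_(i <- s) f i x).
Proof.
move=> cf; elim: s => [|i s IH].
  by under eq_fun do rewrite big_nil; move=> x; exact: cvg_cst.
under eq_fun do rewrite big_cons.
by move=> x; apply: continuousD; [exact: cf|exact: IH].
Qed.

Lemma continuous_mulr (T : topologicalType) (R : realType) (f g : T -> R) :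
  continuous f -> continuous g -> continuous (fun x => f x * g x).
Proof. by move=> cf cg x; apply: cvgM; [exact: cf|exact: cg]. Qed.

Lemma continuous_fun_cst (T : topologicalType) (R : realType) (a : R) :
  continuous (fun _ : T => a).
Proof. by move=> x; exact: cvg_cst. Qed.

Section gamma_max.
Context {R : realType} (n : nat).
Implicit Types (u v : 'rV[R]_n) (A B : 'M[R]_n).

Lemma continuous_qform_vec A : continuous (fun u => qform u A).
Proof.
under eq_fun do rewrite qformE.
apply: continuous_bigsum => i; apply: continuous_bigsum => j.
apply: continuous_mulr; last exact: continuous_fun_cst.
by apply: continuous_mulr; exact: coord_continuous.
Qed.

Lemma continuous_qform_mx u : continuous (fun A => qform u A).
Proof.
under eq_fun do rewrite qformE.
apply: continuous_bigsum => i; apply: continuous_bigsum => j.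
by apply: continuous_mulr; [exact: continuous_fun_cst|exact: coord_continuous].
Qed.

Lemma qform_eq0 u : qform u 1 = 0 -> u = 0.
Proof.
rewrite qform1 => /eqP; rewrite psumr_eq0 => [/allP h|i _]; last exact: sqr_ge0.
apply/rowP => i; have := h i (mem_index_enum _).
by rewrite sqrf_eq0 mxE => /eqP.
Qed.

Lemma unit_coord_le u i : qform u 1 = 1 -> `|u 0 i| <= 1.
Proof.
move=> u1; rewrite -(@ler_pXn2r _ 2) ?nnegrE// expr1n real_normK ?num_real//.
by rewrite -u1 qform1 (bigD1 i)//= lerDl sumr_ge0// => j _; exact: sqr_ge0.
Qed.

Lemma qform_scale (a : R) u A : qform (a *: u) A = a ^+ 2 * qform u A.
Proof.
rewrite /qform -!scalemxAl linearZ/= -scalemxAr scalerA mxE; ring.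
Qed.

Lemma exists_unit u : u != 0 ->
  exists2 v, qform v 1 = 1 & u = Num.sqrt (qform u 1) *: v.
Proof.
move=> u0; set a := Num.sqrt (qform u 1).
have q0 : 0 < qform u 1.
  rewrite lt_neqAle qform1_ge0 andbT eq_sym.
  by apply/eqP => /qform_eq0 /eqP; exact/negP.
have a0 : 0 < a by rewrite sqrtr_gt0.
exists (a^-1 *: u).
  by rewrite qform_scale exprVn sqr_sqrtr ?mulVf ?gt_eqF// ltW.
by rewrite scalerA divff ?scale1r// gt_eqF.
Qed.

Lemma rayleigh_le A (m : R) : (forall v, qform v 1 = 1 -> qform v A <= m) ->
  forall u, qform u A <= m * qform u 1.
Proof.
move=> Am u; have [->|/exists_unit[v v1 ->]] := eqVneq u 0.
  by rewrite /qform !mul0mx !mxE mulr0.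
rewrite !qform_scale v1 mulr1 mulrC ler_wpM2r ?sqr_ge0//.
exact: Am.
Qed.

Lemma eigenvalue_le A (m a : R) :
  (forall v, qform v 1 = 1 -> qform v A <= m) -> eigenvalue A a -> a <= m.
Proof.
move=> /rayleigh_le Am /eigenvalueP[v vA v0]; have := Am v.
rewrite {1}/qform vA -scalemxAl mxE.
have -> : (v *m v^T) 0 0 = qform v 1 by rewrite /qform -[1%R]/(1%:M) mulmx1.
rewrite ler_pM2r// lt_neqAle qform1_ge0 andbT eq_sym.
by apply/eqP => /qform_eq0 /eqP; exact/negP.
Qed.

(** The condition [0 <= m] covers a matrix without eigenvalues, for which the supremum takes the
    default value 0. *)
Lemma gamma_max_le A (m : R) : 0 <= m ->
  (forall v, qform v 1 = 1 -> qform v A <= m) -> gamma_max A <= m.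
Proof.
move=> m0 Am; rewrite /gamma_max.
have [[a Aa]|none] := pselect (exists a, eigenvalue A a).
  apply: ge_sup; first by exists a.
  by move=> b; exact: eigenvalue_le.
by rewrite (_ : [set a | _] = set0) ?sup0// -subset0 => a Aa; apply: none; exists a.
Qed.

Lemma qformDl u v A : A^T = A ->
  qform (u + v) A = qform u A + 2 * (v *m A *m u^T) 0 0 + qform v A.
Proof.
move=> sA; have addE (M N : 'M[R]_1) : (M + N) 0 0 = M 0 0 + N 0 0 by rewrite mxE.
rewrite /qform linearD/= mulmxDl !mulmxDr !mulmxDl !addE.
have -> : (u *m A *m v^T) 0 0 = (v *m A *m u^T) 0 0.
  rewrite -[in LHS]sA -[u in LHS]trmxK -mulmxA -!trmx_mul.
  by rewrite [LHS]mxE.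
by ring.
Qed.

(** [B = m - A] is positive semidefinite with form zero at [v]. If [v *m B] were nonzero, a small
    step against it would make the form negative. *)
Lemma maximizer_eigenvector A v (m : R) : A^T = A -> qform v 1 = 1 ->
  qform v A = m -> (forall u, qform u A <= m * qform u 1) -> v *m A = m *: v.
Proof.
move=> sA v1 vA Am.
pose B := m *: (1 : 'M[R]_n) - A.
have B0 u : 0 <= qform u B by rewrite qformB qformZ subr_ge0.
have sB : B^T = B.
  by rewrite /B linearB/= linearZ/= sA -[1%R]/(1%:M) tr_scalar_mx.
have vB : qform v B = 0 by rewrite qformB qformZ v1 vA mulr1 subrr.
pose g := v *m B; pose N := qform g 1; pose C := qform g B.
suff g0 : g = 0.
  move/eqP: g0; rewrite /g mulmxBr subr_eq0 -scalemxAr -[1%R]/(1%:M) mulmx1.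
  by move/eqP.
apply: qform_eq0; apply/eqP; rewrite eq_le qform1_ge0 andbT leNgt; apply/negP => N0.
rewrite -/N in N0; have C0 : 0 <= C by exact: B0.
(* The 1 keeps the denominator positive when [C] is zero. Since [s * C <= N], the value $-2sN+s^2C$
   is negative. *)
pose s := N / (C + 1).
have s0 : 0 < s by rewrite divr_gt0// ltr_wpDl.
have := B0 (v + (- s) *: g).
rewrite qformDl// vB qform_scale -/C add0r.
rewrite -!scalemxAl mxE.
have -> : (g *m B *m v^T) 0 0 = N.
  rewrite /N /qform -[1%R]/(1%:M) mulmx1 {3}/g trmx_mul sB.
  by rewrite mulmxA.
have sC : s * (C + 1) = N by rewrite /s divfK// gt_eqF// ltr_wpDl.
nra.
Qed.

(** By compactness the form attains its maximum on the unit sphere; the maximiser is an eigenvector,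
    so the maximum is one of the eigenvalues under the supremum. *)
Lemma qform_le_gamma_max A u : A^T = A -> qform u 1 = 1 -> qform u A <= gamma_max A.
Proof.
move=> sA u1; pose S := [set v : 'rV[R]_n | qform v 1 = 1].
have cS : compact S.
  have cube : compact [set v : 'rV[R]_n | forall i, v ord0 i \in `[-1, 1]].
    by apply: (@rV_compact R _ (fun=> `[-1, 1]%classic)) => _; exact: segment_compact.
  apply: subclosed_compact cube _.
    have -> : S = (fun v => qform v 1) @^-1` [set 1] by [].
    move/continuous_closedP: (@continuous_qform_vec 1); apply.
    exact: closed_eq.
  by move=> v /= v1 i; rewrite in_itv/= -ler_norml unit_coord_le.
have [v] : exists2 v, v \in S & forall w, w \in S -> qform w A <= qform v A.
  apply: EVT_max_rV => //; first by exists u.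
  by apply: continuous_subspaceT; exact: continuous_qform_vec.
rewrite inE /S/= => v1 vmax.
have Am w : qform w 1 = 1 -> qform w A <= qform v A.
  by move=> w1; apply: vmax; rewrite inE.
have vA := maximizer_eigenvector sA v1 (erefl _) (rayleigh_le Am).
apply: le_trans (Am _ u1) _; apply: ub_le_sup.
  by exists (qform v A) => a /=; exact: eigenvalue_le.
apply/eigenvalueP; exists v => //; apply/eqP => v0.
move: v1; rewrite v0 /qform !mul0mx mxE => /eqP.
by rewrite eq_sym oner_eq0.
Qed.

End gamma_max.

(** * Finite grids of directions *)

Section grid.
Context {R : realType} (n : nat).
Implicit Types (u v : 'rV[R]_n) (A : 'M[R]_n).

(** Integer vectors with coordinates between $-N$ and $N$. They are left unscaled: homogeneity
    supplies the division by $N^2$. *)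
Definition gridv (N : nat) (g : {ffun 'I_n -> 'I_(2 * N).+1}) : 'rV[R]_n :=
  \row_i ((g i)%:R - N%:R).

Lemma unit_grid u (N : nat) : (0 < N)%N -> qform u 1 = 1 ->
  exists g : {ffun 'I_n -> 'I_(2 * N).+1}, forall A,
    `|qform u A - qform (gridv g) A / N%:R ^+ 2| <=
    2 / N%:R * \sum_i \sum_j `|A i j|.
Proof.
move=> N_gt0 u1; have N0 : 0 < N%:R :> R by rewrite ltr0n.
pose k i := Num.truncn (N%:R * u 0 i + N%:R).
have u_itv i : -1 <= u 0 i <= 1 by rewrite -ler_norml unit_coord_le.
have kP i : (k i)%:R <= N%:R * u 0 i + N%:R < (k i).+1%:R.
  apply: truncn_itv; have /andP[h _] := u_itv i.
  by rewrite -[X in _ + X]mulr1 -mulrDr mulr_ge0 ?(ltW N0)//; lra.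
have kN i : (k i < (2 * N).+1)%N.
  rewrite ltnS -(ler_nat R); have /andP[h _] := kP i; apply: le_trans h _.
  by have /andP[_ h] := u_itv i; rewrite natrM; nra.
pose w i : R := ((k i)%:R - N%:R) / N%:R.
exists [ffun i => Ordinal (kN i)] => A.
have gE i : gridv [ffun i => Ordinal (kN i)] 0 i = N%:R * w i.
  by rewrite mxE ffunE /w mulrC divfK// gt_eqF.
have uw i : `|u 0 i - w i| <= N%:R^-1.
  have /andP[h1 h2] := kP i; rewrite -natr1 in h2.
  have -> : u 0 i - w i = (N%:R * u 0 i + N%:R - (k i)%:R) / N%:R.
    by rewrite /w; field; rewrite gt_eqF.
  by rewrite normrM (@ger0_norm _ N%:R^-1) ?invr_ge0// ler_piMl ?invr_ge0// ger0_norm; lra.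
have w1 i : `|w i| <= 1.
  rewrite /w normrM normfV (@ger0_norm _ N%:R)// ler_pdivrMr// mul1r ler_norml.
  have := kN i; rewrite ltnS -(ler_nat R) natrM => h.
  by have := ler0n R (k i); lra.
rewrite !qformE mulr_suml -sumrB mulr_sumr.
apply: le_trans (ler_norm_sum _ _ _) _; apply: ler_sum => i _.
rewrite mulr_suml -sumrB mulr_sumr.
apply: le_trans (ler_norm_sum _ _ _) _; apply: ler_sum => j _.
rewrite !gE.
have -> : u 0 i * u 0 j * A i j - N%:R * w i * (N%:R * w j) * A i j / N%:R ^+ 2 =
    (u 0 i * (u 0 j - w j) + w j * (u 0 i - w i)) * A i j.
  by field; rewrite gt_eqF.
rewrite normrM ler_wpM2r//; apply: le_trans (ler_normD _ _) _.
rewrite (normrM (u 0 i)) (normrM (w j)) [2 / _]mulrDl -[leRHS]/(1 * _ + 1 * _).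
by apply: lerD; apply: ler_pM; rewrite ?w1 ?uw ?(unit_coord_le _ u1).
Qed.

Let e (i : 'I_n) : 'rV[R]_n := delta_mx 0 i.

Let bilE A i j : (e i *m A *m (e j)^T) 0 0 = A i j.
Proof. by rewrite /e -rowE trmx_delta -colE !mxE. Qed.

Lemma sum_norm1 : \sum_i \sum_j `|(1 : 'M[R]_n) i j| = n%:R.
Proof.
rewrite -[RHS]mulr_natl mulr1 -[in RHS](card_ord n) -sumr_const.
apply: eq_bigr => i _; rewrite (bigD1 i)//= big1 => [|j ji].
  by rewrite !mxE eqxx normr1 addr0.
by rewrite !mxE eq_sym (negPf ji) normr0.
Qed.

(** Polarization on the vectors $e_i$ and $e_i+e_j$ bounds every entry of [A] by [3 * rho].
    [unit_grid] is then used twice: for the identity, giving the error $2n/N$, and for [A], giving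
    $6n^2/N$. *)
Lemma grid_bound A (N : nat) (rho : R) : A^T = A -> (0 < N)%N -> 0 <= rho ->
  (forall g : {ffun 'I_n -> 'I_(2 * N).+1},
     `|qform (gridv g) A| <= rho * qform (gridv g) 1) ->
  (forall i, `|qform (delta_mx 0 i) A| <= rho * qform (delta_mx 0 i) 1) ->
  (forall i j, `|qform (delta_mx 0 i + delta_mx 0 j) A| <=
     rho * qform (delta_mx 0 i + delta_mx 0 j) 1) ->
  forall u, qform u 1 = 1 ->
    qform u A <= rho * (1 + (2 * n%:R + 6 * n%:R ^+ 2) / N%:R).
Proof.
move=> sA N_gt0 r0 gA e1A e2A u u1.
have N0 : 0 < N%:R :> R by rewrite ltr0n.
have s1 : (1 : 'M[R]_n)^T = 1 by rewrite -[1%R]/(1%:M) tr_scalar_mx.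
have A_le i j : `|A i j| <= 3 * rho.
  have := e2A i j; have := e1A i; have := e1A j.
  have d1 k : (1 : 'M[R]_n) k k = 1 by rewrite mxE eqxx.
  have : (1 : 'M[R]_n) j i <= 1 by rewrite mxE lern1 leq_b1.
  have Aji : A j i = A i j by rewrite -[in LHS]sA mxE.
  rewrite !qformDl// /qform !bilE !d1 Aji !mulr1 !ler_norml.
  set b := (1 : 'M[R]_n) j i => b1 /andP[a1 a2] /andP[a3 a4] /andP[a5 a6].
  have rb : rho * b <= rho by rewrite ler_piMr.
  by apply/andP; split; lra.
have [g gu] := unit_grid N_gt0 u1.
have hA := gu A; have h1 := gu 1.
have SA : \sum_i \sum_j `|A i j| <= 3 * rho * n%:R ^+ 2.
  apply: le_trans (_ : \sum_(i < n) \sum_(j < n) 3 * rho <= _).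
    by apply: ler_sum => i _; apply: ler_sum => j _.
  by rewrite !sumr_const !card_ord -mulrnA -[leLHS]mulr_natr natrM -expr2.
rewrite sum_norm1 u1 in h1.
have N20 : 0 < N%:R ^+ 2 :> R by rewrite exprn_gt0.
have gA' : qform (gridv g) A / N%:R ^+ 2 <= rho * (qform (gridv g) 1 / N%:R ^+ 2).
  by rewrite mulrA ler_pM2r ?invr_gt0//; apply: le_trans (ler_norm _) (gA g).
move: hA h1; rewrite !ler_norml => /andP[_ hA] /andP[h1 _].
set a := qform (gridv g) A / _ in hA gA'; set b := qform (gridv g) 1 / _ in h1 gA'.
have b_le : b <= 1 + 2 / N%:R * n%:R by lra.
have hS : 2 / N%:R * \sum_i \sum_j `|A i j| <= 2 / N%:R * (3 * rho * n%:R ^+ 2).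
  by rewrite ler_wpM2l ?divr_ge0// ltW.
have -> : rho * (1 + (2 * n%:R + 6 * n%:R ^+ 2) / N%:R) =
    rho * (1 + 2 / N%:R * n%:R) + 2 / N%:R * (3 * rho * n%:R ^+ 2).
  by field; rewrite gt_eqF.
have : rho * b <= rho * (1 + 2 / N%:R * n%:R) by rewrite ler_wpM2l.
lra.
Qed.

(** A negative value at a unit vector persists at a nearby grid point. Countably many vectors thus
    decide positivity, which makes it an almost sure statement. *)
Lemma qform_ge0_grid A :
  (forall N (g : {ffun 'I_n -> 'I_(2 * N).+1}), 0 <= qform (gridv g) A) ->
  forall u, 0 <= qform u A.
Proof.
move=> gA u; have [->|/exists_unit[v v1 ->]] := eqVneq u 0.
  by rewrite /qform !mul0mx mxE.
rewrite qform_scale mulr_ge0 ?sqr_ge0// leNgt; apply/negP => vA.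
pose S := \sum_i \sum_j `|A i j|.
have S0 : 0 <= S by apply: sumr_ge0 => i _; exact: sumr_ge0.
pose N := (Num.truncn (2 * S / - qform v A)).+1.
have [g /(_ A)] := @unit_grid v N isT v1.
rewrite -/S ler_norml => /andP[h _].
have Nlt : 2 * S / - qform v A < N%:R by exact: truncnS_gt.
have N0 : 0 < N%:R :> R by rewrite ltr0n.
have gA' : 0 <= qform (gridv g) A / N%:R ^+ 2 by rewrite divr_ge0// ltW// exprn_gt0.
have : 2 / N%:R * S < - qform v A.
  by rewrite mulrAC ltr_pdivrMr// [ltRHS]mulrC -ltr_pdivrMr ?oppr_gt0.
lra.
Qed.

End grid.

(** * Borel preimages and almost-everywhere conditional inequalities *)

Section borel.
Context {R : realType} (n : nat).

Lemma borel_mx_preimage (h : 'M[R]_n -> R) : continuous h ->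
  forall B : set R, measurable B -> borel_mx (h @^-1` B).
Proof.
move=> /continuousP ch.
suff mh : measurable_fun setT
    (h : g_sigma_algebraType [set U : set 'M[R]_n | open U] -> R).
  by move=> B mB; rewrite -[_ @^-1` _]setTI; exact: mh.
apply: (measurability _ (RGenOpens.measurableE R)).
move=> _ [_ [a [b ->] <-]]; rewrite setTI; apply: sub_sigma_algebra.
exact/ch/interval_open.
Qed.

End borel.

                              

Section cond_le_more.
Context (d : measure_display) (T : measurableType d) (R : realType).
Variables (P : probability T R) (G : set (set T)).
Hypotheses (sG : sigma_algebra setT G) (Gm : G `<=` measurable).
Implicit Types f g : T -> R.

Lemma integrable_maxr f g : P.-integrable setT (EFin \o f) ->
  P.-integrable setT (EFin \o g) ->
  P.-integrable setT (EFin \o (fun w => Num.max (f w) (g w))).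
Proof.
move=> fi gi; have /measurable_int /measurable_EFinP mf := fi.
have /measurable_int /measurable_EFinP mg := gi.
have fgi := integrableD measurableT (integrable_norm fi) (integrable_norm gi).
apply: (le_integrable measurableT _ _ fgi).
  by apply/measurable_EFinP; exact: measurable_maxr.
move=> w _ /=; rewrite lee_fin [leRHS]ger0_norm ?addr_ge0//.
by case: (leP (f w) (g w)) => _; rewrite ?lerDl ?lerDr ?normr_ge0.
Qed.

Lemma cond_leW_ae f g : P.-integrable setT (EFin \o f) ->
  P.-integrable setT (EFin \o g) -> {ae P, forall w, f w <= g w} ->
  cond_le P G f g.
Proof.
move=> fi gi fg; apply: (cond_le_trans (g := fun w => Num.max (f w) (g w))).
  apply: cond_leW => //; first exact: integrable_maxr.
  by move=> w; rewrite le_max lexx.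
have mi := integrable_maxr fi gi.
split => // B /Gm mB; rewrite (ae_eq_integral (EFin \o g))//.
- by apply: measurable_funTS; exact: measurable_int mi.
- by apply: measurable_funTS; exact: measurable_int gi.
- by apply: filterS fg => w fgw _ /=; rewrite max_r.
Qed.

(** The set where [g] is negative belongs to [G], and the integral of [g] over it is nonnegative, so
    that set is null. *)
Lemma cond_ge0_ae g : cond_le P G (cst 0) g -> measurable_wrt G g ->
  {ae P, forall w, 0 <= g w}.
Proof.
move=> [_ gi g0] mg; pose B := g @^-1` `]-oo, 0[%classic.
have GB : G B by exact: mg.
have mB := Gm GB; have giB : P.-integrable B (EFin \o g) by exact: integrableS gi.
have Bneg w : B w -> g w < 0 by rewrite /B/= in_itv.
have int0 : (\int[P]_(w in B) `|(EFin \o g) w| = 0)%E.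
  apply/eqP; rewrite eq_le integral_ge0// andbT.
  rewrite (eq_integral (fun w => - (g w)%:E)%E); last first.
    by move=> w; rewrite inE => /Bneg gw; rewrite /= ltr0_norm// EFinN.
  rewrite integralN/=; last exact: integrable_add_def giB.
  by rewrite oppe_le0; apply: le_trans (g0 _ GB); rewrite integral_ge0.
have /measurable_int mgB := giB.
have [+ _] := ae_eq_integral_abs P mB mgB.
move=> /(_ int0); apply: filterS => w h; rewrite leNgt; apply/negP => gw.
have Bw : B w by rewrite /B/= in_itv.
by have [] := h Bw => g00; move: gw; rewrite g00 ltxx.
Qed.

Lemma cond_exp_le f g : cond_exp P G f g ->
  cond_le P G f g /\ cond_le P G g f.
Proof. by move=> [fi gi _ fg]; split; split=> // B /fg ->. Qed.

Variable n : nat.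
Implicit Types X Z : T -> 'M[R]_n.

Lemma qform_cond_exp X Z (u : 'rV[R]_n) : cond_exp_mx P G X Z ->
  [/\ cond_le P G (fun w => qform u (X w)) (fun w => qform u (Z w)),
      cond_le P G (fun w => qform u (Z w)) (fun w => qform u (X w)) &
      measurable_wrt G (fun w => qform u (Z w))].
Proof.
move=> XZ; split.
- under eq_fun do rewrite qformE; under [X in cond_le _ _ _ X]eq_fun do rewrite qformE.
  apply: (cond_le_sum Gm) => i; apply: (cond_le_sum Gm) => j.
  by have [] := cond_exp_le (XZ i j); exact: (cond_leZ_eq Gm).
- under eq_fun do rewrite qformE; under [X in cond_le _ _ _ X]eq_fun do rewrite qformE.
  apply: (cond_le_sum Gm) => i; apply: (cond_le_sum Gm) => j.
  by have [xz zx] := cond_exp_le (XZ i j); exact: (cond_leZ_eq Gm).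
- under eq_fun do rewrite qformE.
  apply: measurable_wrt_sum => // i; apply: measurable_wrt_sum => // j.
  apply: measurable_wrtM => //; first exact: measurable_wrt_cst.
  by have [] := XZ i j.
Qed.

(** Each quadratic form of [Z] is nonnegative only off its own null set, so positivity is imposed on
    the countably many grid vectors. Symmetry follows from comparing mirrored entries in both
    directions. *)
Lemma cond_exp_mx_psd X Z : (forall w, (X w)^T = X w) ->
  (forall u w, 0 <= qform u (X w)) -> cond_exp_mx P G X Z ->
  {ae P, forall w, (Z w)^T = Z w /\ forall u, 0 <= qform u (Z w)}.
Proof.
move=> sX X0 XZ.
have sym i j : {ae P, forall w, Z w i j <= Z w j i}.
  have [_ le1] := cond_exp_le (XZ i j); have [le2 _] := cond_exp_le (XZ j i).
  have le3 : cond_le P G (fun w => Z w i j) (fun w => Z w j i).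
    apply: cond_le_trans le1 _.
    rewrite (_ : (fun w => X w i j) = (fun w => X w j i))//.
    by apply/funext => w; rewrite -[in LHS](sX w) mxE.
  have [zi _ _] := le3.
  have := cond_leD Gm le3 (cond_leN Gm (cond_le_refl Gm zi)).
  rewrite [X in cond_le _ _ X](_ : _ = cst 0) => [le4|]; last first.
    by apply/funext => w; rewrite subrr.
  have mz : measurable_wrt G (fun w => Z w j i - Z w i j).
    by apply: measurable_wrtB => //; [have [] := XZ j i|have [] := XZ i j].
  by apply: filterS (cond_ge0_ae le4 mz) => w; rewrite subr_ge0.
have grid N (g : {ffun 'I_n -> 'I_(2 * N).+1}) :
    {ae P, forall w, 0 <= qform (gridv g) (Z w)}.
  have [le1 _ mz] := qform_cond_exp (gridv g) XZ.
  have [qi _ _] := le1.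
  apply: cond_ge0_ae => //; apply: cond_le_trans le1.
  apply: cond_leW => //.
  exact: (finite_measure_integrable_cst P 0).
have symA : {ae P, forall w, forall i j, Z w i j <= Z w j i}.
  by apply: filter_forall => i; apply: filter_forall => j; exact: sym.
have gridA : {ae P, forall w, forall N (g : {ffun 'I_n -> 'I_(2 * N).+1}),
    0 <= qform (gridv g) (Z w)}.
  by apply: ae_foralln => N; apply: filter_forall => g; exact: grid.
apply: filterS2 symA gridA => w sw gw; split; last exact: qform_ge0_grid.
by apply/matrixP => i j; rewrite mxE; apply/eqP; rewrite eq_le !sw.
Qed.

End cond_le_more.

(** * Perturbing the clock, and upper limits *)

Section limsup.
Context {R : realType}.

(** Since $\ln(1+\eta)\le\eta$ and both $\ln V$ and $\ln\ln V$ are at least 1, inflating $V$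
    multiplies $\ln\ln V$ by at most $1+\eta$. The root grows by at most $1+\eta$, and
    $(1+\eta)^2\le 1+3\eta$. *)
Lemma loglog_inflate (eta V M : R) : 0 < eta -> eta <= 1 -> expR (expR 1) <= V ->
  M <= (1 + eta) * Num.sqrt (2 * ((1 + eta) * V) * ln (ln ((1 + eta) * V))) ->
  M <= (1 + 3 * eta) * Num.sqrt (2 * V * ln (ln V)).
Proof.
move=> e0 e1 eV; have V0 : 0 < V by apply: lt_le_trans eV; exact: expR_gt0.
have lV : expR 1 <= ln V by rewrite -ler_expR lnK ?posrE.
have lV0 : 0 < ln V by apply: lt_le_trans lV; exact: expR_gt0.
have llV : 1 <= ln (ln V) by rewrite -ler_expR lnK ?posrE.
have lV1 : 1 <= ln V.
  by apply: le_trans lV; apply: le_trans (expR_ge1Dx _); rewrite lerDl.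
have h0 : 0 < 1 + eta by rewrite addr_gt0.
have le1 : ln ((1 + eta) * V) <= (1 + eta) * ln V.
  rewrite lnM ?posrE//; have : ln (1 + eta) <= eta by apply: le_ln1Dx; lra.
  by nra.
have lV'0 : 0 < ln ((1 + eta) * V).
  by apply: lt_le_trans lV0 _; rewrite ler_ln ?posrE ?mulr_gt0// ler_peMl ?(ltW V0)//; lra.
have le2 : ln (ln ((1 + eta) * V)) <= (1 + eta) * ln (ln V).
  apply: le_trans (_ : ln ((1 + eta) * ln V) <= _).
    by rewrite ler_ln ?posrE ?mulr_gt0.
  rewrite lnM ?posrE//; have : ln (1 + eta) <= eta by apply: le_ln1Dx; lra.
  by nra.
move=> /le_trans; apply.
apply: (@le_trans _ _ ((1 + eta) * ((1 + eta) * Num.sqrt (2 * V * ln (ln V))))).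
  rewrite ler_pM2l// -[X in X * Num.sqrt _]ger0_norm ?(ltW h0)// -sqrtr_sqr.
  rewrite -sqrtrM ?sqr_ge0//; apply: ler_wsqrtr.
  have -> : (1 + eta) ^+ 2 * (2 * V * ln (ln V)) =
    2 * ((1 + eta) * V) * ((1 + eta) * ln (ln V)) by ring.
  by rewrite ler_wpM2l// !mulr_ge0 ?ltW.
by rewrite mulrA ler_wpM2r ?sqrtr_ge0//; nra.
Qed.

Lemma limn_esup_le_near (u : nat -> \bar R) (l : \bar R) :
  (\forall t \near \oo, (u t <= l)%E) -> (limn_esup u <= l)%E.
Proof.
move=> [N _ uN]; rewrite limn_esup_lim; apply: lime_le; first exact: is_cvg_esups.
exists N => // k Nk; apply: ge_ereal_sup => _ [m /= km <-].
by apply: uN => /=; exact: leq_trans km.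
Qed.

End limsup.

(** * The matrix law: from single directions to the largest eigenvalue *)

Section matrix_lil.
Context (disp : measure_display) (T : measurableType disp) (R : realType).
Variables (P : probability T R) (d : nat) (F : nat -> set (set T)).
Variables (Y W : nat -> T -> 'M[R]_d).
Hypothesis d_gt0 : (0 < d)%N.
Hypothesis fF : filtration F.
Hypothesis sY : forall t w, (Y t w)^T = Y t w.
Hypothesis Y0 : forall w, Y 0%N w = 0.
Hypothesis martY : martingale_mx P F Y.
Hypothesis condW : forall t, (1 <= t)%N ->
  cond_exp_mx P (F t.-1) (fun w => increment Y t w ^+ 2) (W t).

Let sF t : sigma_algebra setT (F t). Proof. by case: fF. Qed.
Let Fm t : F t `<=` measurable. Proof. by case: fF. Qed.
Let FS s t : (s <= t)%N -> F s `<=` F t. Proof. by case: fF => _ _; apply. Qed.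

Let V := intrinsic_time W.
Let b t w := Num.sqrt (2 * V t w * ln (ln (V t w))).

Let sX t w : (increment Y t w)^T = increment Y t w.
Proof. by rewrite /increment linearB/= !sY. Qed.

Let psd_path (w : T) :=
  forall t, (W t.+1 w)^T = W t.+1 w /\ forall u, 0 <= qform u (W t.+1 w).

Let psd_path_ae : {ae P, forall w, psd_path w}.
Proof.
apply: ae_foralln => t; have cW := condW (isT : 1 <= t.+1)%N.
apply: (cond_exp_mx_psd (sF t) (@Fm t) _ _ cW) => [w|u w].
  exact: trmx_exp.
by rewrite qform_sqr// qform1_ge0.
Qed.

Let WsumE t w : \sum_(1 <= i < t.+1) W i w = \sum_(i < t) W i.+1 w.
Proof. by rewrite big_add1 big_mkord. Qed.

Let V_ge t w u : psd_path w -> qform u 1 = 1 ->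
  \sum_(i < t) qform u (W i.+1 w) <= V t w.
Proof.
move=> pw u1; rewrite -qform_sum /V /intrinsic_time WsumE.
apply: qform_le_gamma_max => //.
by rewrite raddf_sum/=; apply: eq_bigr => i _; have [] := pw i.
Qed.

Let V_mono w : psd_path w -> {homo (fun t => V t w) : s t / (s <= t)%N >-> s <= t}.
Proof.
move=> pw s t st; have Vt u : qform u 1 = 1 ->
    \sum_(i < s) qform u (W i.+1 w) <= \sum_(i < t) qform u (W i.+1 w).
  move=> u1; rewrite -!(big_mkord xpredT (fun i => qform u (W i.+1 w))).
  rewrite [leRHS](big_cat_nat (n := s))//= lerDl sumr_ge0// => i _.
  by have [_] := pw i.
rewrite {1}/V /intrinsic_time WsumE; apply: gamma_max_le => [|u u1].
  (* [gamma_max_le] asks for [0 <= V t w]; a basis vector, available since [d] is positive,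
     witnesses it. *)
  have e1 : qform (delta_mx 0 (Ordinal d_gt0)) (1 : 'M[R]_d) = 1.
    rewrite qform1 (bigD1 (Ordinal d_gt0))//= big1 => [|i /negPf ij].
      by rewrite mxE !eqxx expr1n addr0.
    by rewrite mxE ij andbF expr0n.
  apply: le_trans (V_ge t pw e1).
  by apply: sumr_ge0 => i _; have [_] := pw i.
by rewrite qform_sum; apply: le_trans (Vt _ u1) (V_ge t pw u1).
Qed.

Let unbounded w :=
  ereal_sup [set (V t w)%:E | t in [set t | (1 <= t)%N]] = +oo%E.

Let V_large w (v : R) : psd_path w -> unbounded w -> \forall t \near \oo, v <= V t w.
Proof.
move=> pw unb; have [[s vs]|none] := pselect (exists s, v <= V s w).
  by exists s => // t st; exact: le_trans vs (V_mono pw st).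
exfalso; have : (ereal_sup [set (V t w)%:E | t in [set t | (1 <= t)%N]] <= v%:E)%E.
  apply: ge_ereal_sup => _ [t _ <-]; rewrite lee_fin leNgt; apply/negP => vt.
  by apply: none; exists t; exact: ltW.
by rewrite unb leye_eq.
Qed.

Section direction.
Variable u : 'rV[R]_d.
Hypothesis u1 : qform u 1 = 1.

Let x t w := qform u (increment Y t.+1 w).
(** [W] is positive semidefinite only almost surely, while the supermartingale arguments ask for a
    compensator that is nonnegative everywhere. *)
Let v t w := Num.max (qform u (W t.+1 w)) 0.

Let mY t : measurable_wrt (F t) (fun w => qform u (Y t w)).
Proof.
under eq_fun do rewrite qformE.
apply: measurable_wrt_sum => // i; apply: measurable_wrt_sum => // j.
apply: measurable_wrtM => //; first exact: measurable_wrt_cst.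
by have [+ _] := martY; apply.
Qed.

Let mx t : measurable_wrt (F t.+1) (x t).
Proof.
rewrite (_ : x t = (fun w => qform u (Y t.+1 w) - qform u (Y t w))).
  apply: measurable_wrtB => //; exact: measurable_wrtS (FS (leqnSn t)) (mY t).
by apply/funext => w; rewrite -qformB.
Qed.

Let mv t : measurable_wrt (F t) (v t).
Proof.
have [_ _ mW] := qform_cond_exp (sF t) (@Fm t) u (condW (isT : 1 <= t.+1)%N).
rewrite (_ : v t = (fun w => Order.max (qform u (W t.+1 w)) 0))//.
apply: (measurable_wrt_comp (sF t) (f := fun r : R => Num.max r 0)) => //.
by apply: measurable_maxr => //; exact: measurable_cst.
Qed.

Let v_ge0 t w : 0 <= v t w.
Proof. by rewrite le_max lexx orbT. Qed.

Let x_sum t w : \sum_(i < t) x i w = qform u (Y t w).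
Proof.
elim: t => [|t IH]; first by rewrite big_ord0 Y0 /qform mulmx0 mul0mx mxE.
by rewrite big_ord_recr/= IH /x /increment/= qformB addrC subrK.
Qed.

Let v_sum t w : psd_path w -> \sum_(i < t) v i w <= V t w.
Proof.
move=> pw; apply: le_trans (V_ge t pw u1); apply: ler_sum => i _.
by rewrite /v max_l//; have [_] := pw i.
Qed.

Let x_mean t : cond_le P (F t) (x t) (cst 0) /\ cond_le P (F t) (cst 0) (x t).
Proof.
have [_ /(_ t) YY] := martY.
have [le1 le2 _] := qform_cond_exp (sF t) (@Fm t) u YY.
have [Yi' Yi _] := le1.
have xE : x t = (fun w => qform u (Y t.+1 w) + - qform u (Y t w)).
  by apply/funext => w; rewrite -qformB.
have E0 : cst 0 = (fun w => qform u (Y t w) + - qform u (Y t w)).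
  by apply/funext => w; rewrite subrr.
have ref := cond_leN (@Fm t) (cond_le_refl (@Fm t) Yi).
by rewrite xE E0; split; exact: (cond_leD (@Fm t)).
Qed.

Let W_v t : cond_le P (F t) (fun w => qform u (W t.+1 w)) (v t).
Proof.
have [le1 _ _] := qform_cond_exp (sF t) (@Fm t) u (condW (isT : 1 <= t.+1)%N).
have [_ Wi _] := le1.
apply: (cond_leW (@Fm t)) => //.
  by apply: integrable_maxr => //; exact: (finite_measure_integrable_cst P 0).
by move=> w; rewrite le_max lexx.
Qed.

Let second_moment t : cond_le P (F t) (fun w => qform u (increment Y t.+1 w ^+ 2)) (v t).
Proof.
have [le1 _ _] := qform_cond_exp (sF t) (@Fm t) u (condW (isT : 1 <= t.+1)%N).
exact: cond_le_trans le1 (W_v t).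
Qed.

Let x2_v t : cond_le P (F t) (fun w => x t w ^+ 2) (v t).
Proof.
apply: cond_le_trans (second_moment t); have [qi _ _] := second_moment t.
have le w : x t w ^+ 2 <= qform u (increment Y t.+1 w ^+ 2) by exact: qform_sqr_le.
apply: (cond_leW (@Fm t)) => //.
apply: (le_integrable measurableT _ _ qi) => [|w _ /=].
  apply/measurable_EFinP; apply: measurable_funX.
  exact: measurable_wrt_fun (@Fm t.+1) (mx t).
by rewrite lee_fin ger0_norm ?sqr_ge0//; apply: le_trans (le w) (ler_norm _).
Qed.

Section bernstein_case.
Hypothesis bernstein : bernstein_mx P F Y W.

(** The sign [sg] treats [Y] and its negative together: the exponential bound depends on [l * sg]
    only through its absolute value and square. *)
Lemma bernstein_direction (sg eps : R) : sg ^+ 2 = 1 -> 0 < eps -> eps <= 1 ->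
  {ae P, forall w, unbounded w -> \forall t \near \oo,
    sg * qform u (Y t w) <= (1 + eps) * b t w}.
Proof.
move=> sg2 e0 e1; have [c c0 bern] := bernstein.
have moments t k : (2 <= k)%N ->
    cond_le P (F t) (fun w => qform u (increment Y t.+1 w ^+ k))
      (fun w => k`!%:R / 2 * c ^+ (k - 2) * v t w).
  rewrite leq_eqVlt => /orP[/eqP <-|k2].
    rewrite (_ : (fun w => _ * v t w) = v t); first exact: second_moment.
    by apply/funext => w; rewrite subnn expr0 mulr1 (_ : 2`! = 2)%N// divff// mul1r.
  have [M cM leM] := bern t.+1 k isT k2.
  have [le1 _ _] := qform_cond_exp (sF t) (@Fm t) u cM.
  set a := k`!%:R / 2 * c ^+ (k - 2).
  have a0 : 0 <= a by rewrite mulr_ge0 ?exprn_ge0 ?divr_ge0// ltW.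
  have [_ Mi _] := le1; have [Wi _ _] := W_v t.
  have leW := cond_leZ (@Fm t) a0 (W_v t).
  apply: cond_le_trans le1 _; apply: cond_le_trans leW.
  apply: (cond_leW_ae (@Fm t)) => //.
    exact: (integrableZl measurableT a Wi).
  apply: filterS leM => w [_ /(_ u)].
  by rewrite -/(qform u _) qformB qformZ subr_ge0.
have norm_sg : `|sg| = 1.
  by apply/eqP; rewrite -(@eqrXn2 _ 2)// real_normK ?num_real// expr1n sg2.
have tail (l a : R) : 0 < l -> l * (3 * c) < 1 ->
  measurable [set w | exists t, a <= l * (sg * qform u (Y t w)) -
     l ^+ 2 / 2 / (1 - l * (3 * c)) * \sum_(i < t) v i w] /\
  (P [set w | exists t, (a <= l * (sg * qform u (Y t w)) -
     l ^+ 2 / 2 / (1 - l * (3 * c)) * \sum_(i < t) v i w)%R] <= (expR (- a))%:E)%E.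
  move=> l0 lc; set psi := l ^+ 2 / 2 / _.
  have nl : `|l * sg| = l by rewrite normrM norm_sg mulr1 gtr0_norm.
  have psi0 : 0 <= psi.
    by rewrite /psi divr_ge0 ?subr_ge0 ?(ltW lc)// divr_ge0 ?sqr_ge0.
  have step t B : F t B ->
      (\int[P]_(w in B) (expR (l * sg * x t w))%:E <=
       \int[P]_(w in B) (1 + psi * v t w)%:E)%E.
    move=> FB; have [m1 m2] := x_mean t.
    have := bernstein_expR (@Fm t) c0 (sX t.+1) u1 (v_ge0 t) m1 m2 (moments t)
      (l := l * sg) _ FB.
    by rewrite nl exprMn sg2 mulr1; apply.
  have me t : measurable_wrt (F t.+1) (fun w => l * sg * x t w).
    by apply: measurable_wrtM => //; exact: measurable_wrt_cst.
  have mp t : measurable_wrt (F t) (fun w => psi * v t w).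
    by apply: measurable_wrtM => //; exact: measurable_wrt_cst.
  have := exponential_ville fF me mp (fun t w => mulr_ge0 psi0 (v_ge0 t w)) step a.
  have E t w : \sum_(i < t) (l * sg * x i w - psi * v i w) =
      l * (sg * qform u (Y t w)) - psi * \sum_(i < t) v i w.
    by rewrite sumrB -!mulr_sumr x_sum mulrA.
  by under eq_set do under eq_exists do rewrite E.
have c3 : 0 <= 3 * c by rewrite mulr_ge0// ltW.
apply: filterS2 psd_path_ae (upper_lil c3 tail e0 e1) => w pw [v0 lil] unb.
near=> t; apply: lil; last exact: v_sum.
by near: t; exact: V_large.
Unshelve. all: by end_near. Qed.

End bernstein_case.

Section iid_case.
Hypothesis iid : iid_mx P (fun t => increment Y t.+1).

Let z t w := x t w ^+ 2.

Let z_preimage t (B : set R) :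
  z t @^-1` B = increment Y t.+1 @^-1` ((fun A => qform u A ^+ 2) @^-1` B).
Proof. by []. Qed.

Let borel_z (B : set R) : measurable B ->
  borel_mx ((fun A : 'M[R]_d => qform u A ^+ 2) @^-1` B).
Proof.
apply: borel_mx_preimage; under eq_fun do rewrite expr2.
by apply: continuous_mulr; exact: continuous_qform_mx.
Qed.

Let mz t : measurable_wrt (F t.+1) (z t).
Proof. by apply: (measurable_wrtM (sF t.+1)). Qed.

Let z_ge0 t w : 0 <= z t w. Proof. exact: sqr_ge0. Qed.

Lemma iid_direction (sg eps : R) : sg ^+ 2 = 1 -> 0 < eps -> eps <= 1 ->
  {ae P, forall w, unbounded w -> \forall t \near \oo,
    sg * qform u (Y t w) <= (1 + 3 * eps) * b t w}.
Proof.
move=> sg2 e0 e1; have [ind ident] := iid.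
have z_id i (B : set R) : measurable B -> P (z i @^-1` B) = P (z 0 @^-1` B).
  by move=> mB; rewrite !z_preimage; apply: ident; exact: borel_z.
have z_indep (s : seq nat) (B : set R) : uniq s -> measurable B ->
  P (\bigcap_(i in [set` s]) (z i @^-1` B)) =
  (\prod_(i <- s) P (z i @^-1` B))%E.
  move=> us mB.
  by apply: (ind s (fun=> (fun A => qform u A ^+ 2) @^-1` B)) => // i; exact: borel_z.
have ratio := iid_dominated_sum_le fF mz mv z_ge0 v_ge0 x2_v z_id z_indep e0.
(* The coefficients 1/6 and 1/3 of the self-normalized exponent are 1/2 times the weights 1/3 and
   2/3. *)
pose A t w := \sum_(i < t) (z i w + 2 * v i w) / 3.
(* This is the hypothesis of [upper_lil] with [c] equal to 0, where [psi l] is exactly $l^2/2$. *)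
have tail (l a : R) : 0 < l -> l * 0 < 1 ->
  measurable [set w | exists t, a <= l * (sg * qform u (Y t w)) -
     l ^+ 2 / 2 / (1 - l * 0) * A t w] /\
  (P [set w | exists t, (a <= l * (sg * qform u (Y t w)) -
     l ^+ 2 / 2 / (1 - l * 0) * A t w)%R] <= (expR (- a))%:E)%E.
  move=> l0 _; rewrite mulr0 subr0 divr1.
  pose e t w := l * sg * x t w - (l * sg) ^+ 2 / 6 * x t w ^+ 2.
  pose p t w := (l * sg) ^+ 2 / 3 * v t w.
  have step t B : F t B ->
      (\int[P]_(w in B) (expR (e t w))%:E <= \int[P]_(w in B) (1 + p t w)%:E)%E.
    move=> FB; have [m1 m2] := x_mean t.
    exact: (self_normalized_expR (@Fm t) m1 m2 (x2_v t) (l * sg) FB).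
  have me t : measurable_wrt (F t.+1) (e t).
    apply: measurable_wrtB => //; apply: measurable_wrtM => //;
      first exact: measurable_wrt_cst.
    exact: measurable_wrt_cst.
  have mp t : measurable_wrt (F t) (p t).
    by apply: measurable_wrtM => //; exact: measurable_wrt_cst.
  have p0 t w : 0 <= p t w by rewrite mulr_ge0// divr_ge0 ?sqr_ge0.
  have := exponential_ville fF me mp p0 step a.
  have E t w : \sum_(i < t) (e i w - p i w) =
      l * (sg * qform u (Y t w)) - l ^+ 2 / 2 * A t w.
    rewrite -x_sum /A !mulr_sumr -sumrB; apply: eq_bigr => i _.
    by rewrite /e /p /z exprMn sg2; field.
  by under eq_set do under eq_exists do rewrite E.
have lilA := upper_lil (lexx 0) tail e0 e1.
apply: filterS3 psd_path_ae lilA ratio => w pw [v0 lil] [N rat] unb.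
near=> t; have VE : expR (expR 1) <= V t w by near: t; exact: V_large.
(* [upper_lil] is applied with [v] equal to [(1 + eps) * V t w], which eventually dominates the
   clock [A t w]. *)
apply: (loglog_inflate e0 e1 VE); apply: lil.
  have Vv : `|v0| <= V t w by near: t; exact: V_large.
  apply: le_trans (ler_norm _) (le_trans Vv _).
  rewrite ler_peMl ?lerDl ?(ltW e0)//.
  by apply: le_trans VE; exact: expR_ge0.
have vV := v_sum t pw.
have zv : \sum_(i < t) z i w <= (1 + eps) * \sum_(i < t) v i w.
  by apply: rat; near: t; exists N.
have -> : A t w = (\sum_(i < t) z i w + 2 * \sum_(i < t) v i w) / 3.
  by rewrite /A mulr_sumr -big_split/= mulr_suml.
rewrite ler_pdivrMr//.
have : (1 + eps) * \sum_(i < t) v i w <= (1 + eps) * V t w.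
  by rewrite ler_wpM2l// addr_ge0// ltW.
have : 0 <= eps * V t w.
  by rewrite mulr_ge0 ?(ltW e0)//; apply: le_trans VE; exact: expR_ge0.
lra.
Unshelve. all: by end_near. Qed.

End iid_case.
End direction.

Hypothesis cases : iid_mx P (fun t => increment Y t.+1) \/ bernstein_mx P F Y W.

Lemma signed_direction u (sg eps : R) : qform u 1 = 1 -> sg ^+ 2 = 1 -> 0 < eps ->
  eps <= 1 -> {ae P, forall w, unbounded w -> \forall t \near \oo,
    sg * qform u (Y t w) <= (1 + eps) * b t w}.
Proof.
move=> u1 sg2 e0 e1; case: cases => [iid|bern]; last exact: bernstein_direction.
have e30 : 0 < eps / 3 by rewrite divr_gt0.
have e31 : eps / 3 <= 1 by lra.
have := iid_direction u1 iid sg2 e30 e31.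
by rewrite (_ : 3 * (eps / 3) = eps)//; field.
Qed.

(** Two-sided and homogeneous in [u], the form that [grid_bound] requires for its vectors, which are
    not of unit length. *)
Lemma direction_bound u (eps : R) : 0 < eps -> eps <= 1 ->
  {ae P, forall w, unbounded w -> \forall t \near \oo,
    `|qform u (Y t w)| <= (1 + eps) * b t w * qform u 1}.
Proof.
move=> e0 e1; have [->|/exists_unit[v v1 ->]] := eqVneq u 0.
  apply: aeW => w _; apply: nearW => t.
  by rewrite /qform !mul0mx mxE normr0 mulr0.
have pos := signed_direction v1 (expr1n R 2) e0 e1.
have neg1 : (- 1 : R) ^+ 2 = 1 by rewrite sqrrN expr1n.
have neg := signed_direction v1 neg1 e0 e1.
apply: filterS2 pos neg => w pos neg unb.
apply: filterS2 (pos unb) (neg unb) => t; rewrite mul1r mulN1r => h1 h2.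
rewrite !qform_scale v1 mulr1 normrM ger0_norm ?sqr_ge0// mulrC ler_wpM2r ?sqr_ge0//.
by rewrite ler_norml lerNl h1 h2.
Qed.

Lemma gamma_max_limsup : {ae P, forall w, unbounded w ->
  (limn_esup (fun t => (gamma_max (Y t w) / b t w)%:E) <= 1)%E}.
Proof.
pose a (m : nat) : R := m.+1%:R^-1.
have a0 m : 0 < a m by rewrite invr_gt0.
have a1 m : a m <= 1 by rewrite invf_le1 ?ler1n.
(* Finiteness of [I] allows a single time after which all the bounds hold together. *)
have good (I : finType) (vec : I -> 'rV[R]_d) (m : nat) : {ae P, forall w, unbounded w ->
    \forall t \near \oo, forall i,
    `|qform (vec i) (Y t w)| <= (1 + a m) * b t w * qform (vec i) 1}.
  have : {ae P, forall w, forall i, unbounded w -> \forall t \near \oo,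
      `|qform (vec i) (Y t w)| <= (1 + a m) * b t w * qform (vec i) 1}.
    by apply: filter_forall => i; exact: direction_bound.
  by apply: filterS => w h unb; apply: filter_forall => i; exact: h.
have grid := ae_foralln (fun m => good _ (@gridv R d m.+1) m).
have basis := ae_foralln (fun m => good 'I_d (fun i => delta_mx 0 i) m).
have pairs := ae_foralln (fun m =>
  good ('I_d * 'I_d)%type (fun ij => delta_mx 0 ij.1 + delta_mx 0 ij.2) m).
have gbp : {ae P, forall w, [/\ psd_path w,
   (forall m, unbounded w -> \forall t \near \oo, forall i,
    `|qform (@gridv R d m.+1 i) (Y t w)| <= (1 + a m) * b t w * qform (gridv i) 1),
   (forall m, unbounded w -> \forall t \near \oo, forall i,
    `|qform (delta_mx 0 i) (Y t w)| <= (1 + a m) * b t w * qform (delta_mx 0 i) 1) &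
   (forall m, unbounded w -> \forall t \near \oo, forall ij : 'I_d * 'I_d,
    `|qform (delta_mx 0 ij.1 + delta_mx 0 ij.2) (Y t w)| <=
    (1 + a m) * b t w * qform (delta_mx 0 ij.1 + delta_mx 0 ij.2) 1)]}.
  by apply: filterS2 (filterI psd_path_ae grid) (filterI basis pairs) => w [? ?] [? ?].
apply: filterS gbp => w [pw gw bw dw] unb.
apply/lee_addgt0Pr => e e0.
pose K : R := 2 * d%:R + 6 * d%:R ^+ 2.
have K0 : 0 <= K by rewrite addr_ge0 ?mulr_ge0 ?exprn_ge0.
(* The total loss is $(1+a)(1+Ka)$ with $a=1/(m+1)\le 1$, hence at most $1+(1+2K)a$; this [m] makes
   it at most [1 + e]. *)
pose m := Num.truncn ((1 + 2 * K) / e).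
have am : (1 + 2 * K) * a m <= e.
  rewrite ler_pdivrMr// [leRHS]mulrC -ler_pdivrMr// ltW//; exact: truncnS_gt.
apply: limn_esup_le_near; near=> t.
rewrite -EFinD lee_fin.
have VE : expR (expR 1) <= V t w by near: t; exact: V_large.
have V0 : 0 < V t w by apply: lt_le_trans VE; exact: expR_gt0.
have b0 : 0 < b t w.
  rewrite sqrtr_gt0 mulr_gt0 ?mulr_gt0//.
  have lV : expR 1 <= ln (V t w) by rewrite -ler_expR lnK ?posrE.
  have lV0 : 0 < ln (V t w) by apply: lt_le_trans lV; exact: expR_gt0.
  apply: lt_le_trans (ltr01) _; rewrite -ler_expR lnK ?posrE//.
rewrite ler_pdivrMr//; apply: gamma_max_le => [|u u1].
  by rewrite mulr_ge0 ?(ltW b0)// addr_ge0// ltW.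
have rho0 : 0 <= (1 + a m) * b t w.
  by rewrite mulr_ge0 ?(ltW b0)// addr_ge0// ltW.
have h1 : forall g : {ffun 'I_d -> 'I_(2 * m.+1).+1}, `|qform (gridv g) (Y t w)| <=
    (1 + a m) * b t w * qform (@gridv R d m.+1 g) 1.
  by near: t; exact: gw.
have h2 : forall i, `|qform (delta_mx 0 i) (Y t w)| <=
    (1 + a m) * b t w * qform (delta_mx 0 i) 1.
  by near: t; exact: bw.
have h3 : forall ij : 'I_d * 'I_d, `|qform (delta_mx 0 ij.1 + delta_mx 0 ij.2) (Y t w)| <=
    (1 + a m) * b t w * qform (delta_mx 0 ij.1 + delta_mx 0 ij.2) 1.
  by near: t; exact: dw.
have := grid_bound (sY t w) (isT : 0 < m.+1)%N rho0 h1 h2 (fun i j => h3 (i, j)) u1.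
move=> /le_trans; apply; rewrite mulrAC ler_pM2r//.
rewrite -/K -/(a m); apply: le_trans (_ : 1 + (1 + 2 * K) * a m <= _); last first.
  by rewrite lerD2l.
have : K * a m * a m <= K * a m by rewrite ler_piMr// mulr_ge0// ltW.
lra.
Unshelve. all: by end_near. Qed.

End matrix_lil.

Theorem corollary4 (disp : measure_display) (T : measurableType disp)
    (R : realType) (P : probability T R) (d : nat) (d_gt0 : (0 < d)%N)
    (F : nat -> set (set T)) (Y : nat -> T -> 'M[R]_d)
    (W : nat -> T -> 'M[R]_d) :
  filtration F ->
  (forall t w, (Y t w)^T = Y t w) ->
  (forall w, Y 0%N w = 0) ->
  martingale_mx P F Y ->
  square_integrable_mx P Y ->
  (forall t, (1 <= t)%N ->
     cond_exp_mx P (F t.-1) (fun w => increment Y t w ^+ 2) (W t)) ->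
  iid_mx P (fun t => increment Y t.+1) \/ bernstein_mx P F Y W ->
  let V := intrinsic_time W in
  {ae P, forall w,
    ereal_sup [set (V t w)%:E | t in [set t | (1 <= t)%N]] = +oo%E ->
    (limn_esup (fun t =>
       (gamma_max (Y t w) / Num.sqrt (2 * V t w * ln (ln (V t w))))%:E)
     <= 1)%E}.
Proof.
move=> fF sY Y0 martY _ condW cases V.
exact: (gamma_max_limsup d_gt0 fF sY Y0 martY condW cases).
Qed.
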